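(* Let $(X,\mathrm{d}\mu)$ be a $\sigma$-finite measure space and let $\mathcal{Y}_1,\dots,\mathcal{Y}_d$ be quasi-normed spaces. Let $T_j:\mathcal{Y}_j\to\mathcal{M}(X)$ be linear operators, each of which saturates $X$. Let $0<p_j\le 2$ for all $j$, and let $\theta_j>0$ with $\sum_{j=1}^d\theta_j=1$. Assume that $$\int_X\prod_{j=1}^d|T_jf_j(x)|^{p_j\theta_j}\,\mathrm{d}\mu(x)\le B\prod_{j=1}^d\|f_j\|_{\mathcal{Y}_j}^{p_j\theta_j}$$ for all $f_j\in\mathcal{Y}_j$, $1\le j\le d$. Suppose moreover that each space $\mathcal{Y}_j$ has Rademacher-type $r_j$, where $r_j=2$ for those $j$ with $p_j=2$, and $r_j>p_j$ for those $j$ with $p_j<2$. Then there exist nonnegative measurable functions $\phi_1,\dots,\phi_d$ on $X$ such that $$\prod_{j=1}^d\phi_j(x)^{\theta_j}\ge 1\quad\text{for a.e. }x\in X,$$ and such that for each $j$, $$\left(\int_X|T_jf_j(x)|^{p_j}\phi_j(x)\,\mathrm{d}\mu(x)\right)^{1/p_j}\le C\,B^{1/p_j}R_{r_j}(\mathcal{Y}_j)\|f_j\|_{\mathcal{Y}_j}\quad\text{for all }f_j\in\mathcal{Y}_j,$$ where $C$ is a finite constant depending only on $\{\theta_j,p_j,r_j\}_{j=1}^d$.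
   Context: $\mathcal{M}(X)$ is the class of measurable functions on $X$. A quasi-normed space is defined like a normed space but with the triangle inequality replaced by $\|x+y\|\le K(\|x\|+\|y\|)$ for some $K\ge 1$. A linear map $T:\mathcal{Y}\to\mathcal{M}(X)$ saturates $X$ if for each measurable $E\subseteq X$ of positive measure there exist a measurable $E'\subseteq E$ with $\mu(E')>0$ and an $h\in\mathcal{Y}$ such that $|Th|>0$ a.e. on $E'$. For $0<r\le 2$, a quasi-normed space $\mathcal{Y}$ has Rademacher-type $r$ if there is a finite constant $R$ such that $\big(\mathbb{E}\|\sum_{k=1}^N\epsilon_kF_k\|_{\mathcal{Y}}^r\big)^{1/r}\le R\big(\sum_{k=1}^N\|F_k\|_{\mathcal{Y}}^r\big)^{1/r}$ for all finite sequences $(F_k)$ in $\mathcal{Y}$, where $(\epsilon_k)$ are independent random variables taking values $\pm1$ with probability $1/2$ each (Rademacher functions); the least such constant is denoted $R_r(\mathcal{Y})$. *)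

(* Defs.v *)
From HB Require Import structures.
From mathcomp Require Import all_boot all_order all_algebra complex.
From mathcomp Require Import all_classical all_reals all_analysis.

Set Implicit Arguments.
Unset Strict Implicit.
Unset Printing Implicit Defensive.

Import Order.TTheory GRing.Theory Num.Theory.

Local Open Scope classical_set_scope.
Local Open Scope ring_scope.

(* Vector spaces and measurable functions are taken over either the real or
   the complex numbers. *)
Variant scalar_kind := RealScalars | ComplexScalars.

Definition scalars (R : realType) (s : scalar_kind) : numFieldType :=
  match s with
  | RealScalars => R
  | ComplexScalars => R[i]
  end.

(* `|z| on R[i] is R[i]-valued, whence the R-valued Normc.normc. *)
Definition modulus (R : realType) (s : scalar_kind) : scalars R s -> R :=
  match s with
  | RealScalars => fun x : R => `|x|
  | ComplexScalars => fun z : R[i] => Normc.normc z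
  end.

Definition measurable_scalar_fun (R : realType) (s : scalar_kind)
    (d : measure_display) (X : measurableType d) :
    (X -> scalars R s) -> Prop :=
  match s with
  | RealScalars => fun f : X -> R => measurable_fun setT f
  | ComplexScalars => fun f : X -> R[i] =>
      measurable_fun setT (fun x => complex.Re (f x)) /\
      measurable_fun setT (fun x => complex.Im (f x))
  end.

Section QuasiNormed.
Variables (R : realType) (s : scalar_kind) (Y : lmodType (scalars R s)).
Implicit Type nrm : Y -> R.

Definition quasi_norm nrm : Prop :=
  [/\ forall y, 0 <= nrm y,
      forall y, nrm y = 0 -> y = 0,
      forall (a : scalars R s) y, nrm (a *: y) = modulus a * nrm y &
      exists2 K : R, 1 <= K & forall y z, nrm (y + z) <= K * (nrm y + nrm z)].

(* The coordinates of a uniformly distributed element of {-1, 1}^N are N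
   independent Rademacher variables; a sign vector is encoded by the exponents
   of -1. *)
Definition rademacher_expectation (N : nat) (g : {ffun 'I_N -> bool} -> R) : R :=
  (\sum_(e : {ffun 'I_N -> bool}) g e) / 2 ^+ N.

Definition rademacher_bound nrm (r c : R) : Prop :=
  forall (N : nat) (F : 'I_N -> Y),
    rademacher_expectation
      (fun e => nrm (\sum_(k < N) (-1) ^+ e k *: F k) `^ r) `^ r^-1
    <= c * (\sum_(k < N) nrm (F k) `^ r) `^ r^-1.

Definition has_rademacher_type nrm (r : R) : Prop :=
  exists2 c : R, 0 <= c & rademacher_bound nrm r c.

(* The infimum is attained as soon as nrm has Rademacher-type r. *)
Definition rademacher_const nrm (r : R) : R :=
  inf [set c : R | 0 <= c /\ rademacher_bound nrm r c].

End QuasiNormed.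

Section Operators.
Variables (R : realType) (s : scalar_kind) (d : measure_display).
Variables (X : measurableType d) (mu : {measure set X -> \bar R}).
Variable Y : lmodType (scalars R s).
Implicit Type T : Y -> X -> scalars R s.

(* Elements of M(X) are determined up to a.e. equality: T picks a measurable
   representative of each image, and linearity is required a.e. only (maps
   that are linear pointwise are a special case). *)
Definition linear_operator T : Prop :=
  (forall f, measurable_scalar_fun (T f)) /\
  (forall (a : scalars R s) f g,
     {ae mu, forall x, T (a *: f + g) x = a * T f x + T g x}).

Definition saturates T : Prop :=
  forall E : set X, measurable E -> (0 < mu E)%E ->
    exists E' : set X,
      [/\ measurable E', E' `<=` E, (0 < mu E')%E &
          exists h : Y, {ae mu, forall x, E' x -> 0 < modulus (T h x)}].

End Operators.

(* Main.v *)
Require Import Defs.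
From HB Require Import structures.
From mathcomp Require Import all_boot all_order all_algebra complex.
From mathcomp Require Import all_classical all_reals all_analysis.
From mathcomp Require Import measurable_realfun.
From mathcomp Require Import ring lra.

(** The theorem combines a duality principle for products of convex sets with a
    randomization that supplies its hypothesis.

    Duality ([multilinear_duality]). Let [G j] be convex sets of nonnegative
    functions such that the integral of the geometric mean of [g j], with weights
    [theta j], is at most [A] for all choices of [g j] in [G j]. If a maximiser [g]
    existed, the weights [phi j := gmean g / g j] would have geometric mean one, and
    the first-order condition in the [j]-th coordinate would bound the integral of
    [h * phi j], for [h] in [G j], by that of [gmean g]. Near-maximisers
    give the same up to constants and truncations ([near_maximiser_weights], tested
    through [perturbation_lower_bound]), after a fixed strictly positive function
    has been added to every coordinate; saturation provides it
    ([positive_minorant], by [exhaustion]). The truncated conditions on [phi] are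
    convex and decrease, and strict convexity of [1 / (1 + u)] extracts from them a
    sequence that converges almost everywhere ([convex_ae_cvg]). Fatou's lemma then
    yields the final weights.

    Randomization ([randomization]). Duality is applied with [G j] the set of sums
    of [w * modulus (T j y) `^ p j] for which the sum of [w * (c j * nrm j y) `^ p j]
    is at most one, [c j] being close to the Rademacher constant. What has to be
    shown is that the assumed inequality for single functions implies the one for
    such sums. Each sum, raised to the power [theta j], is dominated by an average of
    [modulus (T j y) `^ (p j * theta j)] over random [y], namely combinations with
    random signs and random multipliers ([khintchine_lower],
    [random_multipliers_exist]). For [p j = 2] signs suffice. For [p j < 2] the
    multipliers have Pareto tails of exponent [p j], as stable variables do, which
    turns [ell^(p j)] sums into the [ell^(r j)] sums governed by the
    Rademacher-type; this uses [p j < r j] and [theta j < 1]. When [theta j = 1] the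
    average over the members of the family is enough. The variables are
    discretised, so that all averages are finite sums, and expanding the product
    over [j] ([averaged_inequality]) reduces everything to the assumption. *)

Set Implicit Arguments.
Unset Strict Implicit.
Unset Printing Implicit Defensive.

Import Order.TTheory GRing.Theory Num.Theory.
Import numFieldNormedType.Exports.

Local Open Scope classical_set_scope.
Local Open Scope ring_scope.

(** * Inequalities between real powers *)

Section PowerMeans.
Context {R : realType}.
Implicit Types (a b s t x y : R).

Lemma ler_powR2r s x y : 0 <= s -> 0 <= x -> x <= y -> x `^ s <= y `^ s.
Proof.
move=> s0 x0 xy; apply: ge0_ler_powR => //; rewrite nnegrE//.
exact: le_trans xy.
Qed.

Lemma weighted_AMGM t a b : 0 <= t <= 1 -> 0 <= a -> 0 <= b ->
  a `^ t * b `^ (1 - t) <= t * a + (1 - t) * b.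
Proof.
move=> /andP[]; rewrite le_eqVlt => /predU1P[<- _ a0 b0|t0].
  by rewrite powRr0 subr0 powRr1// !mul1r mul0r add0r.
rewrite le_eqVlt => /predU1P[-> a0 b0|t1 a0 b0].
  by rewrite subrr powRr0 powRr1// mulr1 mul1r mul0r addr0.
have t1' : 0 < 1 - t by rewrite subr_gt0.
have := @conjugate_powR R (a `^ t) (b `^ (1 - t)) t^-1 (1 - t)^-1
  (powR_ge0 _ _) (powR_ge0 _ _).
rewrite !invr_gt0 !invrK -!powRrM !divff ?gt_eqF// !powRr1//.
by rewrite [a * t]mulrC [b * _]mulrC; apply => //; rewrite subrKC.
Qed.

(** Summing the tangent bound [x `^ s * m `^ (1 - s) <= s * x + (1 - s) * m] at the
    mean [m]. *)
Lemma powR_jensen (I : finType) (P : pred I) (w x : I -> R) s :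
  0 < s <= 1 -> (forall i, 0 <= w i) -> (forall i, 0 <= x i) ->
  \sum_(i | P i) w i = 1 ->
  \sum_(i | P i) w i * x i `^ s <= (\sum_(i | P i) w i * x i) `^ s.
Proof.
move=> /andP[s0 s1] w0 x0 w1; set m := \sum_(i | P i) w i * x i.
have m0 : 0 <= m by apply: sumr_ge0 => i _; rewrite mulr_ge0.
move: (m0); rewrite le_eqVlt => /predU1P[m_eq0|m_gt0].
  rewrite big1 ?powR_ge0// => i Pi.
  have /eqP : w i * x i = 0.
    apply/eqP; move: Pi; apply/implyP.
    have /esym/psumr_eq0P h : 0 = m by [].
    by apply/implyP => Pi; apply/eqP; apply: h => // k _; rewrite mulr_ge0.
  by rewrite mulf_eq0 => /orP[/eqP ->|/eqP ->];
    rewrite ?mul0r// powR0 ?gt_eqF// mulr0.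
have m1s : 0 < m `^ (1 - s) by rewrite powR_gt0.
rewrite -(ler_pM2r m1s) -powRD ?subrKC ?oner_eq0// powRr1// mulr_suml.
apply: (@le_trans _ _ (\sum_(i | P i) (s * (w i * x i) + (1 - s) * m * w i))).
  apply: ler_sum => i _; rewrite -[leLHS]mulrA.
  have -> : s * (w i * x i) + (1 - s) * m * w i
    = w i * (s * x i + (1 - s) * m) by ring.
  by rewrite ler_wpM2l// weighted_AMGM// ltW.
rewrite big_split/= -!mulr_sumr w1 -/m; lra.
Qed.

(** Each share [x i / m] of the total [m] is at most one, hence at most its power
    of exponent [s <= 1]. *)
Lemma powR_subadd (I : finType) (P : pred I) (x : I -> R) s :
  0 < s <= 1 -> (forall i, 0 <= x i) ->
  (\sum_(i | P i) x i) `^ s <= \sum_(i | P i) x i `^ s.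
Proof.
move=> /andP[s0 s1] x0; set m := \sum_(i | P i) x i.
have m0 : 0 <= m by apply: sumr_ge0.
move: (m0); rewrite le_eqVlt => /predU1P[<-|m_gt0].
  by rewrite powR0 ?gt_eqF// sumr_ge0// => i _; rewrite powR_ge0.
have xm i : P i -> x i <= m.
  by move=> Pi; rewrite /m (bigD1 i)//= lerDl sumr_ge0.
have -> : m `^ s = \sum_(i | P i) x i / m * m `^ s.
  by rewrite -!mulr_suml -/m divff ?gt_eqF// mul1r.
apply: ler_sum => i Pi.
have {2}-> : x i = x i / m * m by rewrite divfK ?gt_eqF.
rewrite powRM ?divr_ge0// ler_wpM2r ?powR_ge0//.
have [->|xi0] := eqVneq (x i) 0; first by rewrite mul0r powR_ge0.
rewrite ger1_powR// divr_gt0//=; last by rewrite lt_neqAle eq_sym xi0 x0.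
by rewrite ler_pdivrMr// mul1r xm.
Qed.

Lemma powR_prod (I : finType) (P : pred I) (x : I -> R) s :
  (forall i, 0 <= x i) ->
  (\prod_(i | P i) x i) `^ s = \prod_(i | P i) x i `^ s.
Proof.
move=> x0; have [] : (\prod_(i | P i) x i) `^ s = \prod_(i | P i) x i `^ s /\
    0 <= \prod_(i | P i) x i; last by [].
elim/big_rec2 : _ => [|i y1 y2 _ [<- h2]]; first by rewrite powR1.
by rewrite powRM// mulr_ge0.
Qed.

Lemma powR_div (t x y : R) : 0 <= x -> 0 <= y -> (x / y) `^ t = x `^ t / y `^ t.
Proof.
by move=> x0 y0; rewrite powRM ?invr_ge0// -!powR_inv1 ?powR_ge0// powRAC.
Qed.

Lemma powR_sum_exp (I : finType) (P : pred I) (e : I -> R) x : 0 < x ->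
  \prod_(i | P i) x `^ e i = x `^ (\sum_(i | P i) e i).
Proof.
move=> x0; elim/big_rec2 : _ => [|i y1 y2 _ ->]; first by rewrite powRr0.
by rewrite powRD//; apply/implyP => _; rewrite gt_eqF.
Qed.

(** First-order expansion of a power, one-sided and with an explicit range. With
    [y := 1 - t + t * u]: if [y <= 1] then [y `^ s >= y]; otherwise [1 <= y <= 2]
    and AM-GM for [y `^ (1 - s)] gives the slope [s / 2]. It measures the gain
    obtained from a near-maximiser by moving one coordinate. *)
Lemma perturbation_lower_bound s t u : 0 < s <= 1 -> 0 < t <= 1 -> 0 <= u ->
  t * u <= 1 -> 1 - t + s / 2 * (t * u) <= (1 - t + t * u) `^ s.
Proof.
move=> /andP[s0 s1] /andP[t0 t1] u0 tu1.
have [y yE] : exists y, y = 1 - t + t * u by eexists.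
rewrite -yE.
have tu0 : 0 <= t * u by rewrite mulr_ge0// ltW.
have [y1|y1] := leP y 1.
  have [y0|y0] := eqVneq y 0.
    have t_1 : 1 - t = 0 by apply/eqP; rewrite eq_le; apply/andP; split; lra.
    have tu_0 : t * u = 0 by apply/eqP; rewrite eq_le; apply/andP; split; lra.
    by rewrite t_1 tu_0 mulr0 addr0 powR_ge0.
  have y0' : 0 < y by rewrite lt_neqAle eq_sym y0 yE addr_ge0// subr_ge0.
  apply: (@le_trans _ _ y); last by rewrite ger1_powR// y0' y1.
  rewrite yE lerD2l ler_piMl//; lra.
have y0 : 0 < y by lra.
have ys : 0 < y `^ (1 - s) by rewrite powR_gt0.
rewrite -(ler_pM2r ys) -powRD ?subrKC ?oner_eq0// powRr1 ?(ltW y0)//.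
have hy : y `^ (1 - s) <= (1 - s) * y + s.
  have := @weighted_AMGM (1 - s) y 1; rewrite powR1 mulr1 => h.
  apply: le_trans (h _ _ _) _ => //; try lra.
have k0 : 0 <= 1 - t + s / 2 * (t * u).
  by rewrite addr_ge0 ?subr_ge0// mulr_ge0// divr_ge0// ltW.
apply: le_trans (ler_wpM2l k0 hy) _.
have hz : t * u = y - 1 + t by lra.
have z1 : 0 <= y - 1 <= 1 by apply/andP; split; lra.
rewrite hz in tu0 tu1 k0 *.
have hz2 : 0 <= (1 - s) * (1 - s) by rewrite mulr_ge0//; lra.
set z := y - 1 in z1 *; have -> : y = 1 + z by rewrite /z; lra.
have -> : 1 - t + s / 2 * (z + t) = 1 + s / 2 * z - t * (1 - s / 2) by lra.
have -> : (1 - s) * (1 + z) + s = 1 + (1 - s) * z by lra.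
move/andP: z1 => [z0 z1].
apply: (@le_trans _ _ ((1 + s / 2 * z) * (1 + (1 - s) * z))).
  rewrite ler_wpM2r//; last by rewrite gerBl mulr_ge0//; lra.
  by rewrite addr_ge0// mulr_ge0//; lra.
have h1 : (1 - s) * (z * z) <= z * 1 * (1 - s).
  by rewrite mulrC ler_wpM2r ?ler_wpM2l//; lra.
have h2 : s * ((1 - s) * (z * z)) <= s * (z * 1).
  rewrite ler_wpM2l ?(ltW s0)//; apply: le_trans h1 _.
  by rewrite ler_piMr//; lra.
nra.
Qed.

Lemma perturbation_lower_bound0 s t u : 0 < s <= 1 -> 0 < t <= 1 -> 0 <= u ->
  1 - t <= (1 - t + t * u) `^ s.
Proof.
move=> s01 t01 u0; have [s0 s1] := andP s01; have [t0 t1] := andP t01.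
have h := @perturbation_lower_bound s t 0 s01 t01 (lexx _).
apply: (@le_trans _ _ ((1 - t + t * 0) `^ s)).
  by have := h; rewrite !mulr0 !addr0; apply; rewrite ler01.
by apply: ler_powR2r; rewrite ?(ltW s0)// !mulr0 ?addr0 ?subr_ge0// lerDl mulr_ge0// ltW.
Qed.

End PowerMeans.

(** * Independent coordinates on a finite product *)

Section FiniteProducts.
Context {R : realType}.

Lemma sum_ffun_prod (I J : finType) (F : I -> J -> R) :
  \sum_(f : {ffun I -> J}) \prod_i F i (f i) = \prod_i \sum_j F i j.
Proof. by rewrite bigA_distr_bigA. Qed.

Lemma mean_ffun_coord (I J : finType) (k : I) (h : J -> R) : (0 < #|J|)%N ->
  (\sum_(f : {ffun I -> J}) h (f k)) / #|J|%:R ^+ #|I| = (\sum_j h j) / #|J|%:R.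
Proof.
move=> J0.
have J0' : #|J|%:R != 0 :> R by rewrite pnatr_eq0 -lt0n.
transitivity ((\prod_i \sum_j (if i == k then h j else 1)) / #|J|%:R ^+ #|I|).
  congr (_ / _); rewrite -sum_ffun_prod; apply: eq_bigr => f _.
  by rewrite -big_mkcond/= big_pred1_eq.
rewrite (bigD1 k)//= eqxx.
have -> : \prod_(i | i != k) \sum_(j : J) (if i == k then h j else 1)
    = \prod_(i | i != k) #|J|%:R :> R.
  by apply: eq_bigr => i /negbTE ->; rewrite sumr_const.
have -> : #|I| = #|[pred i | i != k]|.+1.
  rewrite -[RHS]/#|predC1 k|.+1 cardC1 prednK//.
  by apply/card_gt0P; exists k.
rewrite prodr_const exprS.
by field; rewrite J0' expf_neq0.
Qed.

End FiniteProducts.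

(** * Discrete Pareto variables *)

Section DiscretePareto.
Context {R : realType}.
Implicit Types (t y rho theta : R) (M N n : nat).

Let powRS_split n (e : R) : n.+1%:R `^ (1 - e) = n.+1%:R * n.+1%:R `^ (- e) :> R.
Proof.
by rewrite powRD ?powRr1// pnatr_eq0 implybT.
Qed.

(** The next two bounds replace the comparison of a sum with an integral; both are
    AM-GM after clearing the negative power. *)
Lemma powRN_increment_lt1 t n : 0 < t < 1 ->
  (1 - t) * n.+1%:R `^ (- t) <= n.+1%:R `^ (1 - t) - n%:R `^ (1 - t).
Proof.
move=> /andP[t0 t1].
have := @weighted_AMGM R t n.+1%:R n%:R.
rewrite (ltW t0) (ltW t1) !ler0n => /(_ isT isT isT).
have n0 : 0 < n.+1%:R `^ t :> R by rewrite powR_gt0 ?ltr0Sn.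
rewrite powRS_split powRN; set A := _ `^ t in n0 *; set D := n%:R `^ _.
move=> h; rewrite -(ler_pM2r n0) [leRHS]mulrBl !divfK ?gt_eqF//.
move: h; rewrite -natr1; nra.
Qed.

Lemma powRN_increment_gt1 rho n : 1 < rho -> (0 < n)%N ->
  (rho - 1) * n.+1%:R `^ (- rho) <= n%:R `^ (1 - rho) - n.+1%:R `^ (1 - rho).
Proof.
move=> rho1 n0; have rho0 : 0 < rho by lra.
have n0' : 0 < n%:R :> R by rewrite ltr0n.
have := @weighted_AMGM R rho^-1 (n.+1%:R `^ rho * n%:R `^ (1 - rho)) n%:R.
rewrite invr_ge0 (ltW rho0) invf_le1// (ltW rho1) ler0n mulr_ge0 ?powR_ge0//.
move=> /(_ isT isT isT).
rewrite powRM ?powR_ge0// -!powRrM divff ?gt_eqF// powRr1//.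
rewrite -mulrA -powRD; last by apply/implyP => _; rewrite gt_eqF.
have -> : (1 - rho) / rho + (1 - rho^-1) = 0 by field; rewrite gt_eqF.
rewrite powRr0 mulr1 => h.
have m0 : 0 < n.+1%:R `^ rho :> R by rewrite powR_gt0 ?ltr0Sn.
rewrite powRS_split powRN; move: m0 h.
set A := _ `^ rho; set D := n%:R `^ _ => m0 h.
rewrite -(ler_pM2r m0) [leRHS]mulrBl !divfK ?gt_eqF//.
have {h} := ler_wpM2l (ltW rho0) h.
have -> : rho * (rho^-1 * (A * D) + (1 - rho^-1) * n%:R) = A * D + (rho - 1) * n%:R.
  by field; rewrite gt_eqF.
rewrite -natr1; nra.
Qed.

(** For [eta] uniform on the values [M / m], [1 <= m <= M], a discrete Pareto
    law of exponent one, this bounds the truncated moment of order [theta < 1]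
    over the event that [beta * eta > 1], where [y = M * beta]. *)
Lemma pareto_moment_tail theta y M : 0 < theta < 1 -> 0 <= y ->
  \sum_(m < M) (if m.+1%:R < y then (y / m.+1%:R) `^ theta else 0)
  <= y / (1 - theta).
Proof.
move=> /andP[t0 t1] y0.
pose S n : R := \sum_(m < n) (if m.+1%:R < y then m.+1%:R `^ (- theta) else 0).
have t1' : 0 < 1 - theta by lra.
have SM n : (1 - theta) * S n <= n%:R `^ (1 - theta) /\
            (1 - theta) * S n <= y `^ (1 - theta).
  elim: n => [|n [ih1 ih2]].
    by rewrite /S big_ord0 mulr0 !powR_ge0.
  rewrite /S big_ord_recr/= -/(S n) mulrDr.
  have [ny|ny] := ltP n.+1%:R y; last first.
    rewrite mulr0 addr0; split=> //; apply: le_trans ih1 _.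
    by apply: ler_powR2r; rewrite ?(ltW t1')// ler_nat.
  have h : (1 - theta) * S n + (1 - theta) * n.+1%:R `^ (- theta)
      <= n.+1%:R `^ (1 - theta).
    by have := @powRN_increment_lt1 theta n; rewrite t0 t1 => /(_ isT); lra.
  split=> //; apply: le_trans h _.
  by apply: ler_powR2r; rewrite ?(ltW t1')// ltW.
rewrite ler_pdivlMr//.
have -> : \sum_(m < M) (if m.+1%:R < y then (y / m.+1%:R) `^ theta else 0)
    = y `^ theta * S M.
  rewrite mulr_sumr; apply: eq_bigr => m _; case: ifPn => _; last by rewrite mulr0.
  by rewrite powRM ?invr_ge0// powRN -powR_inv1// powRAC powR_inv1// powR_ge0.
rewrite -mulrA [S M * _]mulrC.
apply: le_trans (ler_wpM2l (powR_ge0 _ _) (SM M).2) _.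
by rewrite -powRD ?subrKC ?oner_eq0// powRr1.
Qed.

(** With [eta] as above, the truncated moment over the complementary event; the sum
    over large [m] is finite uniformly in [M] because its order is [rho > 1]. *)
Lemma pareto_moment_head rho y M : 1 < rho -> 0 <= y ->
  \sum_(m < M) (if y <= m.+1%:R then (y / m.+1%:R) `^ rho else 0)
  <= rho / (rho - 1) * y.
Proof.
move=> rho1; rewrite le_eqVlt => /predU1P[<-|y0].
  rewrite mulr0 big1// => m _; case: ifP => // _.
  by rewrite mul0r powR0// gt_eqF//; lra.
pose S n : R := \sum_(m < n) (if y <= m.+1%:R then m.+1%:R `^ (- rho) else 0).
have r0 : 0 < rho - 1 by lra.
have SM n : if (0 < n)%N && (y <= n%:R)
    then is_true ((rho - 1) * S n <= rho * y `^ (1 - rho) - n%:R `^ (1 - rho))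
    else S n = 0.
  elim: n => [|n]; first by rewrite ltnn/= /S big_ord0.
  rewrite /S big_ord_recr/= -/(S n).
  have [yn1|yn1] := leP y n.+1%:R; last first.
    case: ifPn => [/andP[_ yn]|_ ->]; last by rewrite addr0.
    by move: yn1; rewrite ltNge (le_trans yn)// ler_nat.
  case: ifPn => [/andP[n0 yn] ih|_ ->].
    by rewrite mulrDr; have := @powRN_increment_gt1 rho n rho1 n0; lra.
  rewrite add0r powRS_split.
  have h1 : n.+1%:R `^ (- rho) <= n.+1%:R `^ (1 - rho) :> R.
    by rewrite ler_powR ?ler1n//; lra.
  have h2 : n.+1%:R `^ (1 - rho) <= y `^ (1 - rho).
    rewrite -[1 - rho]opprB !powRN lef_pV2 ?posrE ?powR_gt0 ?ltr0Sn//.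
    by rewrite ler_powR2r// ltW.
  move: h1 h2; rewrite powRS_split; set P := _ `^ (- rho); set Y := y `^ _.
  move=> h1 h2; have : rho * (n.+1%:R * P) <= rho * Y by rewrite ler_wpM2l//; lra.
  have : (rho - 1) * P <= (rho - 1) * (n.+1%:R * P) by rewrite ler_wpM2l// ltW.
  lra.
have {}SM : (rho - 1) * S M <= rho * y `^ (1 - rho).
  have := SM M; case: ifPn => _ h.
    by apply: le_trans h _; rewrite gerBl powR_ge0.
  by rewrite h mulr0 mulr_ge0 ?powR_ge0//; lra.
have -> : \sum_(m < M) (if y <= m.+1%:R then (y / m.+1%:R) `^ rho else 0)
    = y `^ rho * S M.
  rewrite mulr_sumr; apply: eq_bigr => m _; case: ifPn => _; last by rewrite mulr0.
  by rewrite powRM ?invr_ge0 ?(ltW y0)// powRN -powR_inv1// powRAC powR_inv1// powR_ge0.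
rewrite mulrAC ler_pdivlMr// -mulrA [S M * _]mulrC.
apply: le_trans (ler_wpM2l (powR_ge0 _ _) SM) _.
rewrite mulrCA -powRD; last by apply/implyP => _; rewrite gt_eqF.
by rewrite subrKC powRr1// ltW.
Qed.

(** The terms with [beta k * eta k <= 1] are summed inside the power (Jensen), the
    others outside it (subadditivity), so that both parts are linear in [beta].
    The second part is integrable because [theta < 1]. *)
Lemma pareto_upper rho theta N M (beta : 'I_N -> R) :
  1 < rho -> 0 < theta < 1 -> (forall k, 0 <= beta k) ->
  \sum_k beta k <= 1 ->
  (\sum_(f : {ffun 'I_N -> 'I_M.+1})
     (\sum_k (M.+1%:R * beta k / (f k).+1%:R) `^ rho) `^ (theta / rho))
    / M.+1%:R ^+ N
  <= (rho / (rho - 1)) `^ (theta / rho) + (1 - theta)^-1.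
Proof.
move=> rho1 /andP[t0 t1] b0 b1; have rho0 : 0 < rho by lra.
set s := theta / rho.
have s01 : 0 < s <= 1.
  by rewrite /s divr_gt0//= ler_pdivrMr// mul1r; lra.
pose x k m : R := M.+1%:R * beta k / m.+1%:R.
have x0 k m : 0 <= x k m by rewrite /x divr_ge0// mulr_ge0.
pose xl k m : R := if M.+1%:R * beta k <= m.+1%:R then x k m `^ rho else 0.
pose xu k m : R := if m.+1%:R < M.+1%:R * beta k then x k m `^ theta else 0.
have xl0 k m : 0 <= xl k m by rewrite /xl; case: ifP; rewrite ?powR_ge0.
have xu0 k m : 0 <= xu k m by rewrite /xu; case: ifP; rewrite ?powR_ge0.
have MN0 : 0 < (M.+1%:R ^+ N : R) by rewrite exprn_gt0.
have pt (f : {ffun 'I_N -> 'I_M.+1}) : (\sum_k x k (f k) `^ rho) `^ s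
    <= (\sum_k xl k (f k)) `^ s + \sum_k xu k (f k).
  pose z k : R := if (f k).+1%:R < M.+1%:R * beta k then x k (f k) `^ rho else 0.
  have z0 k : 0 <= z k by rewrite /z; case: ifP; rewrite ?powR_ge0.
  have -> : \sum_k x k (f k) `^ rho = \sum_k xl k (f k) + \sum_k z k.
    rewrite -big_split/=; apply: eq_bigr => k _; rewrite /xl /z.
    by case: ltP => _; rewrite ?add0r ?addr0.
  apply: (@le_trans _ _ ((\sum_k xl k (f k)) `^ s + (\sum_k z k) `^ s)).
    have := @powR_subadd R bool predT
      (fun b => if b then \sum_k xl k (f k) else \sum_k z k) s s01.
    by rewrite !big_bool/=; apply => -[]; apply: sumr_ge0.
  rewrite lerD2l; apply: le_trans (@powR_subadd _ _ predT _ _ s01 z0) _.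
  apply: ler_sum => k _; rewrite /z /xu; case: ifP => _.
    by rewrite -powRrM /s mulrCA divff ?gt_eqF// mulr1.
  by rewrite powR0// gt_eqF//; case/andP: s01.
apply: (@le_trans _ _ ((\sum_(f : {ffun 'I_N -> 'I_M.+1})
   ((\sum_k xl k (f k)) `^ s + \sum_k xu k (f k))) / M.+1%:R ^+ N)).
  by rewrite ler_pM2r ?invr_gt0//; apply: ler_sum => f _; exact: pt.
rewrite big_split/= mulrDl; apply: lerD.
  apply: (@le_trans _ _ ((\sum_(f : {ffun 'I_N -> 'I_M.+1})
      (M.+1%:R ^+ N)^-1 * (\sum_k xl k (f k))) `^ s)).
    rewrite mulr_suml; under eq_bigr do rewrite mulrC.
    apply: (@powR_jensen R _ predT (fun=> (M.+1%:R ^+ N)^-1)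
      (fun f : {ffun 'I_N -> 'I_M.+1} => \sum_k xl k (f k))) => //.
    - by move=> f; apply: sumr_ge0.
    - by rewrite sumr_const card_ffun !card_ord -[LHS]mulr_natr natrX mulVf// gt_eqF.
  apply: ler_powR2r; first by case/andP: s01 => /ltW.
    by apply: sumr_ge0 => f _; rewrite mulr_ge0 ?invr_ge0 ?(ltW MN0)// sumr_ge0.
  rewrite -mulr_sumr exchange_big/= mulrC mulr_suml.
  apply: (@le_trans _ _ (\sum_k rho / (rho - 1) * beta k)); last first.
    by rewrite -mulr_sumr ler_piMr// divr_ge0//; lra.
  apply: ler_sum => k _.
  have := @mean_ffun_coord R 'I_N 'I_M.+1 k (fun m => xl k m).
  rewrite !card_ord => ->//; rewrite ler_pdivrMr ?ltr0Sn//.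
  have -> : rho / (rho - 1) * beta k * M.+1%:R
    = rho / (rho - 1) * (M.+1%:R * beta k) by ring.
  by apply: pareto_moment_head => //; rewrite mulr_ge0.
rewrite exchange_big/= mulr_suml.
apply: (@le_trans _ _ (\sum_k (1 - theta)^-1 * beta k)); last first.
  by rewrite -mulr_sumr ler_piMr// invr_ge0; lra.
apply: ler_sum => k _.
have := @mean_ffun_coord R 'I_N 'I_M.+1 k (fun m => xu k m).
rewrite !card_ord => ->//; rewrite ler_pdivrMr ?ltr0Sn//.
have -> : (1 - theta)^-1 * beta k * M.+1%:R = M.+1%:R * beta k / (1 - theta) by ring.
apply: pareto_moment_tail => //.
  by rewrite t0.
by rewrite mulr_ge0.
Qed.

Let count_le y M : (M%:R <= \sum_(m < M) ((m.+1%:R <= y)%R%:R : R)) \/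
  (y - 1 <= \sum_(m < M) ((m.+1%:R <= y)%R%:R : R)).
Proof.
elim: M => [|M ih]; first by rewrite big_ord0; left.
rewrite big_ord_recr/=; have [h|h] := leP M.+1%:R y.
  by rewrite -natr1 -[true%:R]/1; case: ih => ih; [left|right]; lra.
by move: h; rewrite -natr1 -[false%:R]/0 => h; right; case: ih => ih; lra.
Qed.

(** With [M >= 2 * N] equally likely values, rounding loses at most half of the
    total mass, so that some [alpha k * eta k] reaches [1] with probability at
    least [1 / 3] as soon as the [alpha k] sum to one. *)
Lemma pareto_lower theta N M (alpha : 'I_N -> R) :
  (2 * N <= M)%N -> 0 < theta -> (forall k, 0 <= alpha k) ->
  (\sum_k alpha k) `^ theta / 3 <=
  (\sum_(f : {ffun 'I_N -> 'I_M.+1})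
     \big[Num.max/0]_k (M.+1%:R * alpha k / (f k).+1%:R) `^ theta)
    / M.+1%:R ^+ N.
Proof.
move=> NM t0 a0; set A := \sum_k alpha k.
have A0 : 0 <= A by exact: sumr_ge0.
have MN0 : 0 < (M.+1%:R ^+ N : R) by rewrite exprn_gt0.
move: (A0); rewrite le_eqVlt => /predU1P[<-|A_gt0].
  rewrite powR0 ?gt_eqF// mul0r divr_ge0 ?(ltW MN0)// sumr_ge0// => f _.
  exact: bigmax_ge_id.
have M0 : 0 < M.+1%:R :> R by [].
pose v k := M.+1%:R * (alpha k / A).
pose hit k (m : 'I_M.+1) : bool := m.+1%:R <= v k.
pose q k : R := (\sum_m (hit k m)%:R) / M.+1%:R.
have q0 k : 0 <= q k by rewrite divr_ge0// sumr_ge0.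
have q1 k : q k <= 1.
  rewrite ler_pdivrMr// mul1r.
  have -> : M.+1%:R = \sum_(m < M.+1) 1 :> R by rewrite sumr_const card_ord.
  by apply: ler_sum => m _; rewrite lern1 leq_b1.
have qa k : alpha k / A - M.+1%:R^-1 <= q k.
  rewrite ler_pdivlMr// mulrBl mulVf ?gt_eqF// [_ * M.+1%:R]mulrC -/(v k).
  case: (count_le (v k) M.+1) => // h; apply: le_trans h.
  suff : v k <= M.+1%:R by lra.
  rewrite /v ler_piMr// ler_pdivrMr// mul1r /A (bigD1 k)//= lerDl sumr_ge0//.
(* [prod (1 - q) * (1 + sum q) <= 1] stands in for [1 - q <= exp (- q)]. *)
have miss : \prod_k (1 - q k) <= 2 / 3.
  have h : \prod_k (1 - q k) * (1 + \sum_k q k) <= 1 /\ 0 <= \prod_k (1 - q k)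
      /\ 0 <= \sum_k q k.
    elim/big_rec2 : _ => [|k y1 y2 _ [h1 [h2 h3]]]; first by rewrite addr0 mulr1; do !split.
    have := q0 k; have := q1 k => q1k q0k; split; last split.
    - apply: le_trans h1; rewrite -mulrA [(1 - q k) * _]mulrC -mulrA ler_wpM2l//; nra.
    - by rewrite mulr_ge0// subr_ge0.
    - by rewrite addr_ge0.
  have S2 : 2^-1 <= \sum_k q k.
    apply: (@le_trans _ _ (\sum_k (alpha k / A - M.+1%:R^-1))).
      rewrite sumrB -mulr_suml -/A mulfV ?gt_eqF// sumr_const card_ord.
      rewrite -[_ *+ N]mulr_natl.
      suff : N%:R / M.+1%:R <= 2^-1 :> R by move: (_ / _) => z; lra.
      rewrite ler_pdivrMr// mulrC ler_pdivlMr// -natrM ler_nat mulnC.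
      exact: leqW.
    by apply: ler_sum => k _; exact: qa.
  case: h => h1 [h2 _].
  have := ler_wpM2l h2 S2; lra.
have A1 : A `^ theta * (1 - \prod_k (1 - q k)) <=
    (\sum_(f : {ffun 'I_N -> 'I_M.+1})
     \big[Num.max/0]_k (M.+1%:R * alpha k / (f k).+1%:R) `^ theta)
    / M.+1%:R ^+ N.
  have -> : \prod_k (1 - q k) =
    (\sum_(f : {ffun 'I_N -> 'I_M.+1}) \prod_k (~~ hit k (f k))%:R) / M.+1%:R ^+ N.
    rewrite (@sum_ffun_prod R 'I_N 'I_M.+1 (fun k m => (~~ hit k m)%:R)).
    have -> : M.+1%:R ^+ N = \prod_(k < N) M.+1%:R :> R.
      by rewrite prodr_const card_ord.
    rewrite -prodf_div; apply: eq_bigr => k _.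
    have -> : 1 - q k = (M.+1%:R - \sum_m (hit k m)%:R) / M.+1%:R.
      by rewrite mulrBl divff ?gt_eqF.
    congr (_ / _); have -> : M.+1%:R = \sum_(m < M.+1) 1 :> R.
      by rewrite sumr_const card_ord.
    rewrite -sumrB; apply: eq_bigr => m _.
    by case: (hit k m); rewrite ?subrr ?subr0.
  rewrite ler_pdivlMr// -mulrA mulrBl mul1r divfK ?gt_eqF//.
  have -> : (M.+1%:R ^+ N : R) = \sum_(f : {ffun 'I_N -> 'I_M.+1}) 1.
    by rewrite sumr_const card_ffun !card_ord -natrX.
  rewrite -sumrB mulr_sumr; apply: ler_sum => f _.
  have mx0 : 0 <= \big[Num.max/0]_k (M.+1%:R * alpha k / (f k).+1%:R) `^ theta :> R.
    exact: bigmax_ge_id.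
  have [[k hk]|nh] := pselect (exists k, hit k (f k)); last first.
    rewrite big1 ?subrr ?mulr0// => k _; case: (boolP (hit k (f k))) => // hk.
    by case: nh; exists k.
  rewrite (bigD1 k)//= hk mul0r subr0 mulr1.
  apply: le_trans (le_bigmax _ _ k); apply: ler_powR2r; rewrite ?(ltW t0)//.
  move: hk; rewrite /hit /v mulrA ler_pdivlMr// => h.
  by rewrite ler_pdivlMr// mulrC.
apply: le_trans A1; rewrite ler_wpM2l ?powR_ge0//; lra.
Qed.

End DiscretePareto.

(** * The modulus of a real or complex scalar *)

Section Modulus.
Context {R : realType} {s : scalar_kind}.
Implicit Types (z a : scalars R s).

Lemma modulus_ge0 z : 0 <= modulus z.
Proof. by case: s z => /= [z|[a b]]; rewrite ?sqrtr_ge0. Qed.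

Lemma modulus0 : modulus (0 : scalars R s) = 0.
Proof. by case: s => /=; rewrite ?normr0// expr0n/= addr0 sqrtr0. Qed.

Lemma modulusM z a : modulus (z * a) = modulus z * modulus a.
Proof.
case: s z a => /= [z a|]; first by rewrite normrM.
exact: ComplexField.Normc.normcM.
Qed.

Lemma modulus_surj (t : R) : 0 <= t -> exists z : scalars R s, modulus z = t.
Proof.
move=> t0; case: s => /=; first by exists t; rewrite ger0_norm.
by exists t%:C%C; rewrite /= expr0n/= addr0 sqrtr_sqr ger0_norm.
Qed.

Lemma modulus_sign (b : bool) z : modulus ((-1) ^+ b * z) = modulus z.
Proof.
case: b; rewrite ?expr0 ?mul1r// expr1 mulN1r.
by case: s z => /= [z|[a c]]; rewrite ?normrN//= !sqrrN.
Qed.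

(** This identity and the next bound carry the moment computations below for real
    and complex scalars alike. *)
Lemma modulus_parallelogram z a :
  modulus (z + a) ^+ 2 + modulus (- z + a) ^+ 2
  = 2 * (modulus z ^+ 2 + modulus a ^+ 2).
Proof.
case: s z a => /= [z a|[z1 z2] [a1 a2]]; first by rewrite !real_normK ?num_real//; ring.
by rewrite !sqr_sqrtr ?addr_ge0 ?sqr_ge0//; ring.
Qed.

Lemma modulus_cross_term z a :
  (modulus (z + a) ^+ 2 - modulus (- z + a) ^+ 2) ^+ 2
  <= 16 * (modulus z ^+ 2 * modulus a ^+ 2).
Proof.
case: s z a => /= [z a|[z1 z2] [a1 a2]].
  by rewrite !real_normK ?num_real//; rewrite le_eqVlt; apply/orP; left; apply/eqP; ring.
rewrite !sqr_sqrtr ?addr_ge0 ?sqr_ge0// -subr_ge0.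
set e := (X in 0 <= X); have -> : e = 16 * (z1 * a2 - z2 * a1) ^+ 2.
  by rewrite /e; ring.
by rewrite mulr_ge0// sqr_ge0.
Qed.

End Modulus.

(** * Random signs and Khintchine's inequality *)

Section Signs.
Context {R : realType}.
Local Notation E := (@rademacher_expectation R _).

(** Signs are added one at a time, which is how the moments below are computed. *)
Definition cons_sign N (b : bool) (e : {ffun 'I_N -> bool}) :
    {ffun 'I_N.+1 -> bool} :=
  [ffun k => if unlift ord0 k is Some i then e i else b].

Lemma rademacher_expectationS N (g : {ffun 'I_N.+1 -> bool} -> R) :
  E g = (E (fun e => g (cons_sign true e)) + E (fun e => g (cons_sign false e))) / 2.
Proof.
suff key : \sum_e g e =
    \sum_e g (cons_sign true e) + \sum_e g (cons_sign false e).
  by rewrite /rademacher_expectation key exprS; field; rewrite expf_neq0.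
pose F (p : bool * {ffun 'I_N -> bool}) := cons_sign p.1 p.2.
pose G (e : {ffun 'I_N.+1 -> bool}) : bool * {ffun 'I_N -> bool} :=
  (e ord0, [ffun i => e (lift ord0 i)]).
rewrite (reindex F)/=; last first.
  exists G => [[b e] _|e _].
    rewrite /G /F/=; congr pair; first by rewrite ffunE unlift_none.
    by apply/ffunP => i; rewrite !ffunE liftK.
  apply/ffunP => k; rewrite /F /G /= ffunE.
  by case: unliftP => [i ->|->]; rewrite ?ffunE.
rewrite (eq_bigr (fun p => g (cons_sign p.1 p.2)))//.
by rewrite -(pair_bigA _ (fun b e => g (cons_sign b e)))/= big_bool.
Qed.

Lemma rademacher_expectation0 (g : {ffun 'I_0 -> bool} -> R) c :
  (forall e, g e = c) -> E g = c.
Proof.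
move=> gc; rewrite /rademacher_expectation expr0 divr1 (eq_bigr (fun=> c))//.
by rewrite sumr_const card_ffun card_ord expn0 mulr1n.
Qed.

Lemma le_rademacher_expectation N (g h : {ffun 'I_N -> bool} -> R) :
  (forall e, g e <= h e) -> E g <= E h.
Proof.
by move=> gh; rewrite ler_pM2r ?invr_gt0 ?exprn_gt0//; apply: ler_sum => e _.
Qed.

Lemma rademacher_expectation_sum1 N :
  \sum_(e : {ffun 'I_N -> bool}) (2 ^+ N)^-1 = 1 :> R.
Proof.
rewrite sumr_const card_ffun card_ord card_bool -[LHS]mulr_natr natrX.
by rewrite mulVf// expf_neq0.
Qed.

Context {s : scalar_kind}.

Definition rademacher_sum N (a : 'I_N -> scalars R s) (e : {ffun 'I_N -> bool}) :=
  \sum_(k < N) (-1) ^+ e k * a k.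

Lemma rademacher_sum_cons N (a : 'I_N.+1 -> scalars R s) b e :
  rademacher_sum a (cons_sign b e) =
  (-1) ^+ b * a ord0 + rademacher_sum (fun i => a (lift ord0 i)) e.
Proof.
rewrite /rademacher_sum big_ord_recl ffunE unlift_none; congr (_ + _).
by apply: eq_bigr => i _; rewrite ffunE liftK.
Qed.

Lemma rademacher_second_moment N (a : 'I_N -> scalars R s) :
  E (fun e => modulus (rademacher_sum a e) ^+ 2) = \sum_(k < N) modulus (a k) ^+ 2.
Proof.
elim: N a => [|N ih] a.
  rewrite big_ord0; apply: rademacher_expectation0 => e.
  by rewrite /rademacher_sum big_ord0 modulus0 expr0n.
rewrite rademacher_expectationS big_ord_recl -ih /rademacher_expectation.
rewrite -mulrDl -big_split/=.
rewrite (eq_bigr (fun e => 2 * (modulus (a ord0) ^+ 2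
   + modulus (rademacher_sum (fun i => a (lift ord0 i)) e) ^+ 2))); last first.
  move=> e _; rewrite !rademacher_sum_cons expr1 expr0 mulN1r mul1r addrC.
  exact: modulus_parallelogram.
rewrite -mulr_sumr big_split/= sumr_const card_ffun card_ord card_bool.
rewrite -[_ *+ (2 ^ N)]mulr_natr natrX.
by field; rewrite expf_neq0.
Qed.

Lemma rademacher_fourth_moment N (a : 'I_N -> scalars R s) :
  E (fun e => modulus (rademacher_sum a e) ^+ 4)
  <= 3 * (\sum_(k < N) modulus (a k) ^+ 2) ^+ 2.
Proof.
elim: N a => [|N ih] a.
  rewrite big_ord0 expr0n mulr0 (@rademacher_expectation0 _ 0)// => e.
  by rewrite /rademacher_sum big_ord0 modulus0 expr0n.
rewrite rademacher_expectationS big_ord_recl.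
set A := modulus (a ord0) ^+ 2.
pose a' i := a (lift ord0 i).
have A0 : 0 <= A by rewrite sqr_ge0.
pose Z e := modulus (rademacher_sum a' e) ^+ 2.
have h e : modulus (rademacher_sum a (cons_sign true e)) ^+ 4
         + modulus (rademacher_sum a (cons_sign false e)) ^+ 4
    <= 2 * (A ^+ 2 + 6 * A * Z e + modulus (rademacher_sum a' e) ^+ 4).
  rewrite !rademacher_sum_cons expr1 expr0 mulN1r mul1r -/a' -[4%N]/(2 * 2)%N !exprM -/(Z e).
  have := modulus_parallelogram (a ord0) (rademacher_sum a' e).
  have := modulus_cross_term (a ord0) (rademacher_sum a' e).
  rewrite -/A -/(Z e).
  set u := modulus (a ord0 + _) ^+ 2; set v := modulus (- a ord0 + _) ^+ 2.
  move=> h1 h2.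
  have -> : v ^+ 2 + u ^+ 2 = ((u + v) ^+ 2 + (u - v) ^+ 2) / 2 by field.
  rewrite h2; nra.
have {h} H := @le_rademacher_expectation N _ _ h.
have S2 := rademacher_second_moment a'; have S4 := ih a'.
set S := \sum_(k < N) _ in S2 S4 *.
move: H S2 S4; rewrite /rademacher_expectation -/(Z _).
set P := \sum_e Z e; set Q := \sum_e modulus (rademacher_sum a' e) ^+ 4.
have -> : \sum_e 2 * (A ^+ 2 + 6 * A * Z e + modulus (rademacher_sum a' e) ^+ 4)
    = 2 * (A ^+ 2 * 2 ^+ N + 6 * A * P + Q).
  rewrite -mulr_sumr 2!big_split/= -[\sum_e 6 * A * Z e]mulr_sumr.
  by rewrite sumr_const card_ffun card_ord card_bool -[_ *+ (2 ^ N)]mulr_natr natrX.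
rewrite big_split/= mulrDl; set X := _ + _.
have n2 : (2 ^+ N : R) != 0 by rewrite expf_neq0.
have -> : 2 * (A ^+ 2 * 2 ^+ N + 6 * A * P + Q) / 2 ^+ N =
  2 * (A ^+ 2 + 6 * A * (P / 2 ^+ N) + Q / 2 ^+ N) by field.
move=> H S2; rewrite S2 in H => S4.
nra.
Qed.

(** Khintchine's lower bound, for exponents up to two.  For [u >= 0] of mean
    one with second moment at most three, [u `^ t >= u - u ^+ 2 / 4] integrates
    to [1 / 4]. *)
Lemma khintchine_lower (t : R) N (a : 'I_N -> scalars R s) : 0 < t <= 1 ->
  (\sum_(k < N) modulus (a k) ^+ 2) `^ t / 4
  <= E (fun e => modulus (rademacher_sum a e) `^ (2 * t)).
Proof.
move=> /andP[t0 t1]; set S := \sum_(k < N) _.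
have S0 : 0 <= S by apply: sumr_ge0 => k _; rewrite sqr_ge0.
move: (S0); rewrite le_eqVlt => /predU1P[<-|S_gt0].
  rewrite powR0 ?gt_eqF// mul0r divr_ge0 ?exprn_ge0// sumr_ge0// => e _.
  exact: powR_ge0.
pose Z e := modulus (rademacher_sum a e) ^+ 2.
have pt e : S `^ t * (Z e / S - modulus (rademacher_sum a e) ^+ 4 / (4 * S ^+ 2))
    <= modulus (rademacher_sum a e) `^ (2 * t).
  rewrite powRrM powR_mulrn ?modulus_ge0// -/(Z e).
  rewrite -[4%N]/(2 * 2)%N exprM -/(Z e).
  have Z0 : 0 <= Z e by rewrite sqr_ge0.
  have {3}-> : Z e = S * (Z e / S) by rewrite mulrCA divff ?gt_eqF// mulr1.
  rewrite [in leRHS]powRM ?divr_ge0// ler_wpM2l ?powR_ge0//.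
  have -> : Z e ^+ 2 / (4 * S ^+ 2) = (Z e / S) ^+ 2 / 4 by field; rewrite gt_eqF.
  have : 0 <= Z e / S by rewrite divr_ge0.
  move: (Z e / S) => u u0.
  have [u1|u1] := leP 1 u.
    apply: (@le_trans _ _ 1).
      rewrite -subr_ge0 (_ : 1 - _ = (u / 2 - 1) ^+ 2) ?sqr_ge0//; by field.
    by rewrite -[leLHS](@powRr0 _ u) ler_powR// ltW.
  have [->|un0] := eqVneq u 0; first by rewrite expr0n/= mul0r subr0 powR_ge0.
  apply: (@le_trans _ _ u); first by rewrite gerBl divr_ge0// sqr_ge0.
  by rewrite ger1_powR// lt_neqAle eq_sym un0 u0 ltW.
apply: le_trans (le_rademacher_expectation pt).
have S2 := rademacher_second_moment a; have S4 := rademacher_fourth_moment a.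
move: S2 S4; rewrite /rademacher_expectation -mulr_sumr sumrB -!mulr_suml -/S -/(Z _).
set P := \sum_e Z e; set Q := \sum_e _ => S2 S4.
have n2 : (2 ^+ N : R) != 0 by rewrite expf_neq0.
have -> : S `^ t * (P / S - Q / (4 * S ^+ 2)) / 2 ^+ N =
   S `^ t * (P / 2 ^+ N / S - Q / 2 ^+ N / (4 * S ^+ 2)).
  by field; rewrite gt_eqF//= n2.
rewrite S2 divff ?gt_eqF// ler_wpM2l ?powR_ge0//.
have : Q / 2 ^+ N / (4 * S ^+ 2) <= 3 / 4.
  rewrite ler_pdivrMr ?mulr_gt0 ?exprn_gt0//; apply: le_trans S4 _; lra.
move: (_ / (4 * _)) => z; lra.
Qed.

End Signs.

(** * Random multipliers *)

Section RandomMultipliers.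
Context {R : realType}.

(** [zeta] is a random vector of multipliers whose law gives mass [v o] to the
    outcome [o]; [r] is the Rademacher-type of the space to be mapped. *)
Definition random_multipliers (theta p r K : R) N (w : 'I_N -> R) (O : finType)
    (v : O -> R) (zeta : O -> 'I_N -> R) : Prop :=
  [/\ forall o, 0 <= v o, forall o k, 0 <= zeta o k,
      forall alpha : 'I_N -> R, (forall k, 0 <= alpha k) ->
        (\sum_k w k * alpha k `^ p) `^ theta
        <= K * \sum_o v o * (\sum_k (zeta o k * alpha k) ^+ 2) `^ (p * theta / 2) &
      forall beta : 'I_N -> R, (forall k, 0 <= beta k) ->
        \sum_k w k * beta k `^ p <= 1 ->
        \sum_o v o * (\sum_k (zeta o k * beta k) `^ r) `^ (p * theta / r) <= K].

(** Stable-type multipliers [zeta k], whose [p]-th power is Pareto up to the weight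
    [w k]: the largest of the [zeta k * alpha k] already sees the [ell^p] norm,
    while the [ell^r] norm of [zeta k * beta k] has finite moments of order below
    [p]. *)
Lemma random_multipliers_pareto (theta p r : R) :
  0 < theta < 1 -> 0 < p < r ->
  let K := 3 + ((r / p / (r / p - 1)) `^ (theta / (r / p)) + (1 - theta)^-1) in
  forall N (w : 'I_N -> R), (forall k, 0 <= w k) ->
  exists (O : finType) (v : O -> R) (zeta : O -> 'I_N -> R),
    random_multipliers theta p r K w v zeta.
Proof.
move=> /andP[t0 t1] /andP[p0 pr] K N w w0.
have [M NM] : exists M, (2 * N <= M)%N by exists (2 * N)%N.
have MN0 : 0 < (M.+1%:R ^+ N : R) by rewrite exprn_gt0.
have r0 : 0 < r by lra.
have rho1 : 1 < r / p by rewrite ltr_pdivlMr// mul1r.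
pose K2 := (r / p / (r / p - 1)) `^ (theta / (r / p)) + (1 - theta)^-1.
rewrite -[K]/(3 + K2).
have K20 : 0 <= K2.
  by rewrite addr_ge0 ?powR_ge0// invr_ge0; lra.
pose zeta (f : {ffun 'I_N -> 'I_M.+1}) k := (M.+1%:R * w k / (f k).+1%:R) `^ p^-1.
have zE f k (a : R) : 0 <= a ->
    (zeta f k * a) `^ p = M.+1%:R * (w k * a `^ p) / (f k).+1%:R.
  move=> a0; rewrite powRM ?powR_ge0// -powRrM mulVf ?gt_eqF// powRr1; first by ring.
  by rewrite divr_ge0// mulr_ge0.
exists {ffun 'I_N -> 'I_M.+1}, (fun=> (M.+1%:R ^+ N)^-1), zeta.
split=> [_|f k|a a0|b b0 b1].
- by rewrite invr_ge0 ltW.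
- exact: powR_ge0.
- have := @pareto_lower R theta N M (fun k => w k * a k `^ p) NM t0.
  move=> /(_ (fun k => mulr_ge0 (w0 k) (powR_ge0 _ _))) h.
  rewrite -mulr_sumr.
  apply: (@le_trans _ _ (3 * ((M.+1%:R ^+ N)^-1 * \sum_(f : {ffun 'I_N -> 'I_M.+1})
      (\sum_k (zeta f k * a k) ^+ 2) `^ (p * theta / 2)))); last first.
    rewrite ler_wpM2r ?lerDl// mulr_ge0 ?invr_ge0 ?(ltW MN0)//.
    by apply: sumr_ge0 => f _; exact: powR_ge0.
  rewrite -ler_pdivrMl// mulrC; apply: le_trans h _.
  rewrite mulrC ler_pM2l ?invr_gt0//; apply: ler_sum => f _.
  apply: bigmax_le => [|k _]; first exact: powR_ge0.
  rewrite -zE// -powRrM.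
  have za : 0 <= zeta f k * a k by rewrite mulr_ge0 ?powR_ge0.
  have -> : (zeta f k * a k) `^ (p * theta)
      = ((zeta f k * a k) ^+ 2) `^ (p * theta / 2).
    by rewrite -powR_mulrn// -powRrM; congr (_ `^ _); field.
  apply: ler_powR2r.
  + by rewrite divr_ge0// mulr_ge0 ?ltW.
  + exact: sqr_ge0.
  + by rewrite (bigD1 k)//= lerDl sumr_ge0// => i _; exact: sqr_ge0.
- have := @pareto_upper R (r / p) theta N M (fun k => w k * b k `^ p) rho1.
  rewrite t0 t1 => /(_ isT (fun k => mulr_ge0 (w0 k) (powR_ge0 _ _)) b1) h.
  rewrite -mulr_sumr mulrC; apply: (@le_trans _ _ K2); last by rewrite lerDr.
  rewrite -/K2 in h.
  refine (le_trans _ h).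
  rewrite ler_pM2r; last by rewrite invr_gt0.
  apply: ler_sum => f _.
  have -> : p * theta / r = theta / (r / p) by field; rewrite !gt_eqF.
  rewrite le_eqVlt; apply/orP; left; apply/eqP; congr (_ `^ _).
  apply: eq_bigr => k _; rewrite -zE// -powRrM; congr (_ `^ _).
  by field; rewrite gt_eqF.
Qed.

(** Multipliers turning [ell^p] sums into the [ell^2] and [ell^r] sums that random
    signs control: powers of Pareto variables in general, constants when [p = 2],
    and the choice of a single term when [theta = 1], where the Pareto tail is
    not integrable. *)
Lemma random_multipliers_exist (theta p r : R) :
  0 < theta <= 1 -> 0 < p <= 2 -> (p = 2 -> r = 2) -> (p < 2 -> p < r) ->
  exists2 K : R, 0 < K & forall N (w : 'I_N -> R), (forall k, 0 <= w k) ->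
  exists (O : finType) (v : O -> R) (zeta : O -> 'I_N -> R),
    random_multipliers theta p r K w v zeta.
Proof.
move=> /andP[t0 t1] /andP[p0 p2] hr2 hpr.
have rp : p <= r.
  move: p2; rewrite le_eqVlt => /predU1P[p2|/hpr/ltW//].
  by rewrite hr2// p2.
have r0 : 0 < r by apply: lt_le_trans rp.
move: t1; rewrite le_eqVlt => /predU1P[->|t1].
  exists 1 => // N w w0.
  exists 'I_N, (fun=> 1), (fun o k => if o == k then w k `^ p^-1 else 0).
  split=> // [i k|a a0|b b0 b1]; first by case: ifP; rewrite ?powR_ge0.
    rewrite powRr1; last by apply: sumr_ge0 => k _; rewrite mulr_ge0 ?powR_ge0.
    rewrite mul1r; apply: ler_sum => o _; rewrite mul1r mulr1.
    rewrite (bigD1 o)//= eqxx big1 => [|k ko]; last first.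
      by rewrite eq_sym (negbTE ko) mul0r expr0n.
    rewrite addr0 -powR_mulrn ?mulr_ge0 ?powR_ge0// -powRrM mulrCA divff// mulr1.
    by rewrite powRM ?powR_ge0// -powRrM mulVf ?gt_eqF// powRr1.
  apply: le_trans b1; apply: ler_sum => o _; rewrite mul1r mulr1.
  rewrite (bigD1 o)//= eqxx big1 => [|k ko]; last first.
    by rewrite eq_sym (negbTE ko) mul0r powR0// gt_eqF.
  rewrite addr0 -powRrM mulrCA divff ?gt_eqF// mulr1.
  by rewrite powRM ?powR_ge0// -powRrM mulVf ?gt_eqF// powRr1.
move: p2; rewrite le_eqVlt => /predU1P[p2|/hpr pr]; last first.
  have K0 : 0 < (1 - theta)^-1 by rewrite invr_gt0; lra.
  eexists; last by apply: random_multipliers_pareto; rewrite ?t0 ?t1 ?p0.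
  by rewrite ltr_wpDr ?addr_ge0 ?powR_ge0 ?(ltW K0).
exists 1 => // N w w0; exists unit, (fun=> 1), (fun=> fun k => Num.sqrt (w k)).
rewrite (hr2 p2) p2; have tE : 2 * theta / 2 = theta by field.
have U (g : unit -> R) : \sum_o g o = g tt.
  by rewrite (bigD1 tt)//= big1 ?addr0// => -[].
split=> //; rewrite ?tE; [move=> a a0|move=> b b0 b1].
  rewrite mul1r U mul1r.
  rewrite le_eqVlt; apply/orP; left; apply/eqP; congr (_ `^ _).
  by apply: eq_bigr => k _; rewrite exprMn sqr_sqrtr// powR_mulrn.
rewrite U mul1r.
have -> : \sum_k (Num.sqrt (w k) * b k) `^ 2 = \sum_k w k * b k `^ 2.
  apply: eq_bigr => k _; rewrite powR_mulrn ?mulr_ge0 ?sqrtr_ge0//.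
  by rewrite exprMn sqr_sqrtr// powR_mulrn.
move: b1; set S := \sum_k _ => S1.
have S0 : 0 <= S by apply: sumr_ge0 => k _; rewrite mulr_ge0 ?powR_ge0.
by have := ler_powR2r (ltW t0) S0 S1; rewrite powR1.
Qed.

End RandomMultipliers.

(** * Operators that are linear almost everywhere *)

Section LinearOperators.
Context {R : realType} {s : scalar_kind} {d : measure_display}.
Context {X : measurableType d} {mu : {measure set X -> \bar R}}.
Context {Y : lmodType (scalars R s)} {T : Y -> X -> scalars R s}.
Hypothesis lT : linear_operator mu T.

Lemma linear_operator0 : {ae mu, forall x, T 0 x = 0}.
Proof.
have [_ /(_ 1 0 0)] := lT; rewrite scaler0 addr0.
apply: filterS => x; rewrite mul1r -[LHS]addr0 => /addrI/esym.
by [].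
Qed.

Lemma linear_operator_sum N (c : 'I_N -> scalars R s) (f : 'I_N -> Y) :
  {ae mu, forall x, T (\sum_k c k *: f k) x = \sum_k c k * T (f k) x}.
Proof.
elim: N c f => [|N ih] c f.
  by apply: filterS linear_operator0 => x; rewrite !big_ord0.
have h := lT.2 (c ord0) (f ord0) (\sum_k c (lift ord0 k) *: f (lift ord0 k)).
apply: filterS2 h (ih (fun k => c (lift ord0 k)) (fun k => f (lift ord0 k))).
by move=> x h1 h2; rewrite !big_ord_recl h1 h2.
Qed.

Lemma measurable_modulus (f : Y) : measurable_fun setT (fun x => modulus (T f x)).
Proof.
have := lT.1 f; rewrite /measurable_scalar_fun.
move: (T f); case: (s) => /= [g mg|g [mr mi]]; first exact: measurableT_comp.
have -> : (fun x => Normc.normc (g x)) =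
    (fun x => (complex.Re (g x) ^+ 2 + complex.Im (g x) ^+ 2) `^ 2^-1).
  apply/funext => x; rewrite powR12_sqrt ?addr_ge0 ?sqr_ge0//.
  by case: (g x).
apply: (@measurableT_comp _ _ _ _ _ _ (@powR R ^~ 2^-1)) => //.
by apply: measurable_funD; exact: measurable_funX.
Qed.

End LinearOperators.

(** * Randomization of a finite family *)

Section Randomization.
Context {R : realType}.

Lemma ae_forall_finType d (X : measurableType d) (mu : {measure set X -> \bar R})
    (I : finType) (P : I -> X -> Prop) :
  (forall i, {ae mu, forall x, P i x}) -> {ae mu, forall x, forall i, P i x}.
Proof.
move=> h; have : {ae mu, forall x, forall n : nat, forall i, nth i (enum I) n = i ->
   (n < #|I|)%N -> P i x}.
  apply: ae_foralln => n.
  case: (ltnP n #|I|) => [nI|nI]; last first.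
    by apply: aeW => x i _.
  have i0 : I by exact: enum_val (Ordinal nI).
  apply: filterS (h (nth i0 (enum I) n)) => x Px i <- _.
  by rewrite (set_nth_default i0)// -cardE.
apply: filterS => x Px i; apply: (Px (enum_rank i)) => //.
exact: nth_enum_rank.
Qed.

(** An estimate for single functions, averaged over the list [z], yields one for the
    weighted [ell^p] sums of the list [u]. The constant must not depend on the
    operator nor on the spaces, whence the quantification over all of them. *)
Definition randomizes (theta p r K : R) : Prop :=
  forall (s : scalar_kind) d (X : measurableType d) (mu : {measure set X -> \bar R})
    (Y : lmodType (scalars R s)) (nrm : Y -> R) (T : Y -> X -> scalars R s) (c : R),
  quasi_norm nrm -> linear_operator mu T -> 0 <= c -> rademacher_bound nrm r c ->
  forall u : seq (R * Y), (forall a, a \in u -> 0 <= a.1) ->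
  \sum_(a <- u) a.1 * (c * nrm a.2) `^ p <= 1 ->
  exists z : seq (R * Y),
  [/\ forall i, 0 <= (nth (0, 0) z i).1,
      {ae mu, forall x, (\sum_(a <- u) a.1 * modulus (T a.2 x) `^ p) `^ theta
        <= K * \sum_(a <- z) a.1 * modulus (T a.2 x) `^ (p * theta)} &
      \sum_(a <- z) a.1 * nrm a.2 `^ (p * theta) <= K].

(** The list [z] consists of the combinations of the members of [u] with random
    multipliers and random signs: Khintchine's inequality bounds their images
    from below and the Rademacher-type bounds their norms from above. *)
Lemma randomization (theta p r : R) :
  0 < theta <= 1 -> 0 < p <= 2 -> (p = 2 -> r = 2) -> (p < 2 -> p < r) ->
  exists2 K : R, 0 < K & randomizes theta p r K.
Proof.
move=> t01 p02 hr2 hpr; have [t0 t1] := andP t01; have [p0 p2] := andP p02.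
have rp : p <= r.
  move: (p2); rewrite le_eqVlt => /predU1P[p2'|/hpr/ltW//].
  by rewrite hr2// p2'.
have r0 : 0 < r by apply: lt_le_trans rp.
have [K K0 HK] := random_multipliers_exist t01 p02 hr2 hpr.
exists (4 * K); first by rewrite mulr_gt0.
move=> s d X mu Y nrm T c [n0 _ nZ _] lT c0 rb u u0 u1.
set N := size u; pose uk (k : 'I_N) := tnth (in_tuple u) k.
pose w k := (uk k).1; pose f k := (uk k).2.
have w0 k : 0 <= w k by apply: u0; exact: mem_tnth.
have [Om [v [zeta [v0 z0 lower upper]]]] := HK N w w0.
have /choice[z zE] : forall ok : Om * 'I_N, exists z : scalars R s,
    modulus z = zeta ok.1 ok.2 by move=> ok; exact: modulus_surj.
pose y (oe : Om * {ffun 'I_N -> bool}) :=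
  \sum_k (-1) ^+ oe.2 k *: (z (oe.1, k) *: f k).
pose V (oe : Om * {ffun 'I_N -> bool}) := v oe.1 / 2 ^+ N.
have V0 oe : 0 <= V oe by rewrite divr_ge0.
exists [seq (V oe, y oe) | oe <- enum {: Om * {ffun 'I_N -> bool}}]; split.
- move=> i; have [iz|iz] := ltnP i (size [seq (V oe, y oe) |
      oe <- enum {: Om * {ffun 'I_N -> bool}}]); last by rewrite nth_default.
  have [oe] : exists oe, nth (0, 0) [seq (V oe, y oe) |
      oe <- enum {: Om * {ffun 'I_N -> bool}}] i = (V oe, y oe).
    move: iz; elim: (enum _) i => // oe l ih [|i] h; first by exists oe.
    exact: ih.
  by move=> ->; exact: V0.
- have H : {ae mu, forall x, forall oe,
      T (y oe) x = \sum_k (-1) ^+ oe.2 k * (z (oe.1, k) * T (f k) x)}.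
    apply: ae_forall_finType => oe.
    apply: filterS (linear_operator_sum lT
      (fun k => (-1) ^+ oe.2 k * z (oe.1, k)) f) => x h.
    rewrite /y (eq_bigr (fun k => ((-1) ^+ oe.2 k * z (oe.1, k)) *: f k)).
      by rewrite h; apply: eq_bigr => k _; rewrite mulrA.
    by move=> k _; rewrite scalerA.
  apply: filterS H => x H; rewrite big_map big_enum/=.
  rewrite big_tnth; apply: le_trans (lower (fun k => modulus (T (f k) x)) _) _.
    by move=> k; exact: modulus_ge0.
  rewrite -[leRHS]mulrA [leRHS]mulrCA ler_pM2l//.
  rewrite (eq_bigr (fun oe => V (oe.1, oe.2) * modulus (T (y (oe.1, oe.2)) x) `^ (p * theta)));
    last by case.
  rewrite -(pair_bigA _ (fun o e => V (o, e) * modulus (T (y (o, e)) x) `^ (p * theta)))/=.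
  rewrite mulr_sumr; apply: ler_sum => o _.
  have pt01 : 0 < p * theta / 2 <= 1.
    rewrite divr_gt0 ?mulr_gt0//= ler_pdivrMr// mul1r.
    by apply: le_trans p2; rewrite ler_piMr// ltW.
  have := @khintchine_lower R s _ N (fun k => z (o, k) * T (f k) x) pt01.
  have -> : 2 * (p * theta / 2) = p * theta by field.
  rewrite ler_pdivrMr// => h.
  have -> : \sum_(k < N) (zeta o k * modulus (T (f k) x)) ^+ 2
      = \sum_(k < N) modulus (z (o, k) * T (f k) x) ^+ 2.
    by apply: eq_bigr => k _; rewrite modulusM zE.
  apply: le_trans (ler_wpM2l (v0 o) h) _.
  rewrite le_eqVlt; apply/orP; left; apply/eqP.
  rewrite [4 * _]mulrC mulrA; congr (_ * 4).
  rewrite /rademacher_expectation mulrA [in LHS]mulrAC mulr_sumr.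
  by apply: eq_bigr => e _; rewrite H /V.
- rewrite big_map big_enum/=.
  rewrite (eq_bigr (fun oe => V (oe.1, oe.2) * nrm (y (oe.1, oe.2)) `^ (p * theta)));
    last by case.
  rewrite -(pair_bigA _ (fun o e => V (o, e) * nrm (y (o, e)) `^ (p * theta)))/=.
  apply: (@le_trans _ _ K); last by lra.
  rewrite big_tnth in u1.
  have {upper} := upper (fun k => c * nrm (f k)) (fun k => mulr_ge0 c0 (n0 _)) u1.
  apply: le_trans; apply: ler_sum => o _.
  have -> : \sum_e V (o, e) * nrm (y (o, e)) `^ (p * theta) =
      v o * \sum_e (2 ^+ N)^-1 * nrm (y (o, e)) `^ (p * theta).
    by rewrite mulr_sumr; apply: eq_bigr => e _; rewrite mulrA.
  rewrite ler_wpM2l//.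
  set s' := p * theta / r.
  have s01 : 0 < s' <= 1.
    rewrite divr_gt0 ?mulr_gt0//= ler_pdivrMr// mul1r.
    by apply: le_trans rp; rewrite ler_piMr// ltW.
  have Es' : r * s' = p * theta by rewrite mulrCA divff ?gt_eqF// mulr1.
  apply: (@le_trans _ _ ((rademacher_expectation
     (fun e => nrm (y (o, e)) `^ r)) `^ s')).
    have := @powR_jensen R {ffun 'I_N -> bool} predT (fun=> (2 ^+ N)^-1)
      (fun e => nrm (y (o, e)) `^ r) s' s01 (fun=> _) (fun=> powR_ge0 _ _)
      (rademacher_expectation_sum1 N).
    rewrite -[X in X `^ s']mulr_sumr /rademacher_expectation mulrC.
    move=> h; apply: le_trans (h _); last by rewrite invr_ge0 exprn_ge0.
    rewrite le_eqVlt; apply/orP; left; apply/eqP.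
    by apply: eq_bigr => e _; rewrite -powRrM Es' mulrC.
  have {rb} := rb N (fun k => z (o, k) *: f k).
  set Er := rademacher_expectation _ => rb.
  have Er0 : 0 <= Er.
    by rewrite divr_ge0 ?exprn_ge0// sumr_ge0// => e _; exact: powR_ge0.
  have -> : Er `^ s' = (Er `^ r^-1) `^ (p * theta).
    by rewrite -powRrM; congr (_ `^ _); rewrite /s' mulrC.
  apply: le_trans (ler_powR2r _ (powR_ge0 _ _) rb) _.
    by rewrite mulr_ge0 ?ltW.
  rewrite le_eqVlt; apply/orP; left; apply/eqP.
  have F0 (g : 'I_N -> R) : 0 <= \sum_k g k `^ r.
    by apply: sumr_ge0 => k _; exact: powR_ge0.
  have -> : \sum_k (zeta o k * (c * nrm (f k))) `^ r =
      c `^ r * \sum_k nrm (z (o, k) *: f k) `^ r.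
    rewrite mulr_sumr; apply: eq_bigr => k _.
    by rewrite nZ zE/= mulrCA [LHS]powRM// mulr_ge0.
  rewrite powRM ?powR_ge0// [in RHS]powRM ?powR_ge0// -!powRrM Es'.
  by congr (_ * _ `^ _); rewrite /s' mulrC.
Qed.

End Randomization.

(** * Exhaustion of a sigma-finite space *)

Section FiniteEquivalent.
Context {R : realType} {d : measure_display} {X : measurableType d}.

(** Weighted sum of the restrictions of [mu] to a cover by sets of finite measure. *)
Lemma sigma_finite_dominating (mu : {measure set X -> \bar R}) :
  sigma_finite setT mu ->
  exists nu : {measure set X -> \bar R}, (nu setT < +oo)%E /\
    forall A, measurable A -> nu A = 0%E -> mu A = 0%E.
Proof.
move=> [F FT Ffin].
have mF n : measurable (F n) by case: (Ffin n).
pose c n : R := (1 / (2 ^ n.+1)%:R) / (1 + fine (mu (F n))).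
have c0 n : 0 < c n.
  by rewrite divr_gt0 ?divr_gt0 ?ltr0n ?expn_gt0// ltr_pwDl// fine_ge0.
pose m n : {measure set X -> \bar R} :=
  mscale (NngNum (ltW (c0 n))) (mrestr mu (mF n)).
exists (mseries m 0); split=> [|A mA].
  apply: (@le_lt_trans _ _ 1%:E); last exact: ltry.
  apply: le_trans (@epsilon_trick0 R 1 xpredT ler01).
  apply: lee_nneseries => // n _.
  have -> : m n setT = ((c n)%:E * mu (F n))%E by rewrite /m/= /mscale/= /mrestr setTI.
  rewrite -(@fineK _ (mu (F n))) ?ge0_fin_numE ?(Ffin n).2// -EFinM lee_fin.
  have f0 : 0 <= fine (mu (F n)) by exact: fine_ge0.
  rewrite /c mulrAC ler_pdivrMr ?ltr_pwDl// ler_wpM2l ?divr_ge0// lerDr.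
  by [].
rewrite /= /mseries => nuA0.
have h n : mu (A `&` F n) = 0%E.
  have : (m n A <= 0)%E.
    rewrite -nuA0; have := @nneseries_split_cond R (fun k => m k A) 0 n.+1 xpredT.
    move=> ->//; rewrite add0n big_mkcond/= big_nat_recr//= -[leLHS]add0e.
    by rewrite -addeA leeD// ?sume_ge0// leeDl// nneseries_ge0.
  rewrite /m/= /mscale/= pmule_rle0 ?lte_fin//.
  by rewrite measure_le0 => /eqP.
apply/eqP; rewrite -measure_le0 -[A]setIT FT setI_bigcupr.
apply: le_trans (@measure_sigma_subadditive _ _ _ mu _ (fun n => A `&` F n) _ _ _) _.
- by move=> n; exact: measurableI.
- by apply: bigcupT_measurable => n; exact: measurableI.
- by [].
- by rewrite eseries0// => n _ _; exact: h.
Qed.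

(** The total finite mass covered by countably many sets of [P] has a supremum, and
    it is attained by gathering the sets of a maximising sequence; a remainder
    of positive measure would contain one more set of [P]. *)
Lemma exhaustion (mu : {measure set X -> \bar R}) (P : set (set X)) :
  sigma_finite setT mu ->
  P set0 -> (forall A B, measurable A -> A `<=` B -> P B -> P A) ->
  (forall A, measurable A -> (0 < mu A)%E ->
    exists B, [/\ measurable B, B `<=` A, (0 < mu B)%E & P B]) ->
  exists E : nat -> set X, [/\ forall n, measurable (E n), forall n, P (E n),
    trivIset setT E & mu (~` \bigcup_n E n) = 0%E].
Proof.
move=> sf P0 Psub Pex.
have [nu [nufin numu]] := sigma_finite_dominating sf.
have nufinA A : measurable A -> nu A \is a fin_num.
  exact: lty_fin_num_fun.
pose good (E : nat -> set X) := (forall n, measurable (E n)) /\ (forall n, P (E n)).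
pose V := [set v : \bar R | exists2 E, good E & v = nu (\bigcup_n E n)].
have Vfin : ereal_sup V \is a fin_num.
  rewrite fin_real//; apply/andP; split.
    apply: (@lt_le_trans _ _ 0%E); first exact: ltNyr.
    apply: ereal_sup_ubound; exists (fun=> set0); first by split.
    by rewrite bigcup0 ?measure0.
  apply: le_lt_trans nufin; apply: ge_ereal_sup => _ [E [mE _] ->].
  by apply: le_measure; rewrite ?inE//; exact: bigcupT_measurable.
have /choice[E HE] : forall n : nat, exists E, good E /\
    (ereal_sup V - (n.+1%:R^-1)%:E < nu (\bigcup_k E k))%E.
  move=> n; have n0 : 0 < n.+1%:R^-1 :> R by rewrite invr_gt0.
  have [_ [E gE ->] h] := ub_ereal_sup_adherent n0 Vfin.
  by exists E.
pose G m : set X := if (unpickle m : option (nat * nat)) is Some ij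
  then E ij.1 ij.2 else set0.
have gG : good G.
  by split=> m; rewrite /G; case: unpickle => // ij; case: (HE ij.1).1.
have EG n : \bigcup_k E n k `<=` \bigcup_m G m.
  by move=> x [k _ Ex]; exists (pickle (n, k)) => //; rewrite /G pickleK.
have mG : measurable (\bigcup_m G m) by apply: bigcupT_measurable; case: gG.
have Gsup : (ereal_sup V <= nu (\bigcup_m G m))%E.
  apply/lee_addgt0Pr => e e0.
  have [n ne] : exists n : nat, n.+1%:R^-1 < e.
    exists (Num.truncn e^-1); rewrite invf_plt ?posrE//.
    by rewrite truncnS_gt.
  rewrite -leeBlDr//; apply: (@le_trans _ _ (ereal_sup V - (n.+1%:R^-1)%:E)%E).
    by rewrite leeB// lee_fin ltW.
  apply: le_trans (ltW (HE n).2) _; apply: le_measure; rewrite ?inE//.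
  by apply: bigcupT_measurable; case: (HE n).1.
exists (seqDU G); split.
- by apply: seqDU_measurable; case: gG.
- move=> n; apply: Psub (gG.2 n); last exact: subset_seqDU.
  by apply: seqDU_measurable; case: gG.
- exact: trivIset_seqDU.
- rewrite -seqDU_bigcup_eq; apply/eqP; apply/negPn/negP => mu0.
  have mC : measurable (~` \bigcup_m G m) by exact: measurableC.
  have [|B [mB BC B0 PB]] := Pex _ mC; first by rewrite measure_gt0.
  have nuB0 : (0 < nu B)%E.
    by rewrite measure_gt0; apply: contraTneq B0 => /(numu _ mB) ->; rewrite ltxx.
  pose H m := if m is m'.+1 then G m' else B.
  have HU : \bigcup_m H m = B `|` \bigcup_m G m.
    apply/seteqP; split=> [x [[|m] _ Hx]|x [Bx|[m _ Gx]]].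
    - by left.
    - by right; exists m.
    - by exists 0%N.
    - by exists m.+1.
  have : (nu (\bigcup_m H m) <= ereal_sup V)%E.
    apply: ereal_sup_ubound; exists H => //; split=> -[|m]//=; case: gG => //.
  rewrite HU measureU//; last first.
    by apply/seteqP; split=> // x [/BC].
  move=> h; have := le_trans h Gsup.
  rewrite -[leRHS]add0e leeD2rE ?nufinA// leNgt nuB0.
  by [].
Qed.

End FiniteEquivalent.

(** * Almost everywhere limits from decreasing convex sets *)

Section ConvexCompactness.
Context {R : realType}.

Lemma cvgn_weighted_increments (a : nat -> R) :
  (\sum_(n <oo) (4 ^+ n * (a n - a n.+1) ^+ 2)%:E < +oo)%E -> cvgn a.
Proof.
set S := (\sum_(n <oo) _)%E => Sfin.
have S0 : (0 <= S)%E.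
  by apply: nneseries_ge0 => n _ _; rewrite lee_fin mulr_ge0 ?sqr_ge0 ?exprn_ge0.
have bnd n : `|telescope a n| <= geometric (Num.sqrt (fine S)) 2^-1 n.
  rewrite /telescope/= -(ler_pXn2r (n := 2))// ?nnegrE ?mulr_ge0 ?sqrtr_ge0 ?exprn_ge0//.
  rewrite real_normK ?num_real// exprMn sqr_sqrtr ?fine_ge0//.
  rewrite -exprM mulnC exprM -(ler_pM2l (_ : 0 < 4 ^+ n)) ?exprn_gt0//.
  rewrite [leRHS]mulrCA -exprMn.
  have -> : 4 * (2^-1) ^+ 2 = 1 :> R by field.
  rewrite expr1n mulr1 -lee_fin fineK ?ge0_fin_numE//.
  have -> : (a n.+1 - a n) ^+ 2 = (a n - a n.+1) ^+ 2 by ring.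
  rewrite /S (@nneseries_split_cond R _ 0 n.+1 xpredT); last first.
    by move=> k _; rewrite lee_fin mulr_ge0 ?sqr_ge0 ?exprn_ge0.
  rewrite add0n big_mkcond/= big_nat_recr//= -[leLHS]add0e -addeA leeD//.
    by rewrite sume_ge0// => k _; rewrite lee_fin mulr_ge0 ?sqr_ge0 ?exprn_ge0.
  rewrite leeDl// nneseries_ge0// => k _ _.
  by rewrite lee_fin mulr_ge0 ?sqr_ge0 ?exprn_ge0.
have : cvgn (series (telescope a)).
  apply: normed_cvg; apply: series_le_cvg bnd _.
  - by move=> n /=; exact: normr_ge0.
  - by move=> n; rewrite /= mulr_ge0 ?sqrtr_ge0 ?exprn_ge0// invr_ge0.
  - by apply: is_cvg_geometric_series; rewrite ger0_norm ?invr_ge0// invf_lt1// ltr1n.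
move=> h; have -> : a = (fun n => a 0%N + series (telescope a) n).
  by apply/funext => n; rewrite -eq_sum_telescope.
by apply: is_cvgD => //; exact: is_cvg_cst.
Qed.

(** Strict convexity of the reciprocal, in quantitative form. *)
Lemma inv1D_midpoint (u v : R) : 0 <= u -> 0 <= v ->
  ((1 + u)^-1 - (1 + v)^-1) ^+ 2
  <= 4 * (((1 + u)^-1 + (1 + v)^-1) / 2 - (1 + (u + v) / 2)^-1).
Proof.
move=> u0 v0.
have U0 : 0 < 1 + u by lra.
have V0 : 0 < 1 + v by lra.
have -> : (1 + (u + v) / 2)^-1 = 2 / ((1 + u) + (1 + v)).
  by field; do ?[apply/andP; split]; rewrite gt_eqF//; lra.
have -> : 4 * (((1 + u)^-1 + (1 + v)^-1) / 2 - 2 / (1 + u + (1 + v)))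
  = ((1 + u)^-1 - (1 + v)^-1) ^+ 2 * (2 * ((1 + u) * (1 + v)) / (1 + u + (1 + v))).
  by field; do ?[apply/andP; split]; rewrite gt_eqF//; lra.
rewrite ler_peMr ?sqr_ge0// ler_pdivlMr; last by lra.
nra.
Qed.

Context {d : measure_display} {X : measurableType d}.
Variable nu : {measure set X -> \bar R}.
Hypothesis nufin : (nu setT < +oo)%E.

Lemma integrable_inv1D (f : X -> R) : measurable_fun setT f ->
  (forall x, 0 <= f x) -> nu.-integrable setT (EFin \o (fun x => (1 + f x)^-1)).
Proof.
move=> mf f0; apply: measurable_bounded_integrable => //.
- have -> : (fun x => (1 + f x)^-1) = (fun x => (1 + f x) `^ (-1)).
    by apply/funext => x; rewrite powR_inv1// addr_ge0.
  apply: (@measurableT_comp _ _ _ _ _ _ (@powR R ^~ (-1))) => //.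
  exact: measurable_funD.
- exists 1; split; first exact: num_real.
  move=> M M1 x _ /=; rewrite ger0_norm ?invr_ge0 ?addr_ge0//.
  by apply: le_trans (ltW M1); rewrite invf_le1 ?lerDl// ltr_pwDl.
Qed.

(** A compactness principle in the style of Komlos. The function [1 / (1 + u)] is
    bounded and strictly convex, so that near-minimisers of its integral over
    decreasing convex sets are nearly equal. Convergence is stated for the
    reciprocals because the functions themselves may tend to infinity. *)
Lemma convex_ae_cvg (I : finType) (K : nat -> set (I -> X -> R)) :
  (forall n, K n.+1 `<=` K n) -> (forall n, K n !=set0) ->
  (forall n phi j, K n phi -> measurable_fun setT (phi j)) ->
  (forall n phi j x, K n phi -> 0 <= phi j x) ->
  (forall n phi psi, K n phi -> K n psi ->
    K n (fun j x => (phi j x + psi j x) / 2)) ->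
  exists h : nat -> I -> X -> R, (forall n, K n (h n)) /\
    {ae nu, forall x, forall j, cvgn (fun n => (1 + h n j x)^-1)}.
Proof.
move=> Ksub K0 Km Kge Kmid.
have Kle m n : (m <= n)%N -> K n `<=` K m.
  move=> /subnKC <-; elim: (n - m)%N => [|k ih]; first by rewrite addn0.
  by rewrite addnS; exact: subset_trans ih.
pose J (phi : I -> X -> R) : R := \sum_j \int[nu]_x (1 + phi j x)^-1.
have J0 n phi : K n phi -> 0 <= J phi.
  move=> Kphi; apply: sumr_ge0 => j _; apply: Rintegral_ge0 => x _.
  by rewrite invr_ge0 addr_ge0// (Kge _ _ _ _ Kphi).
have int n phi j : K n phi -> nu.-integrable setT (EFin \o (fun x => (1 + phi j x)^-1)).
  by move=> h; apply: integrable_inv1D; [exact: Km h|move=> x; exact: Kge h].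
pose c : R := #|I|%:R * fine (nu setT).
have Jc n phi : K n phi -> J phi <= c.
  move=> Kphi; rewrite /c mulr_natl -sumr_const; apply: ler_sum => j _.
  rewrite -[leRHS]mul1r -(@Rintegral_cst _ _ _ nu setT measurableT 1).
  apply: le_Rintegral => //; first exact: int Kphi.
  - apply: measurable_bounded_integrable => //.
    exists 1; split; first exact: num_real.
    by move=> M M1 x _ /=; rewrite normr1 ltW.
  - move=> x _; rewrite invf_le1 ?lerDl ?(Kge _ _ _ _ Kphi)//.
    by rewrite ltr_pwDl// (Kge _ _ _ _ Kphi).
pose I_ n := inf (J @` K n).
have hasinf n : has_inf (J @` K n).
  split; first by have [phi Kphi] := K0 n; exists (J phi), phi.
  by exists 0 => _ [phi Kphi <-]; exact: J0 Kphi.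
have I_le n phi : K n phi -> I_ n <= J phi.
  by move=> Kphi; apply: ge_inf; [exact: (hasinf n).2|exists phi].
have Ind m n : (m <= n)%N -> I_ m <= I_ n.
  move=> mn; apply: lb_le_inf; first exact: (hasinf n).1.
  by move=> _ [phi Kphi <-]; apply: I_le; exact: Kle Kphi.
have Isup : has_sup (range I_).
  split; first by exists (I_ 0%N), 0%N.
  exists c => _ [n _ <-]; have [phi Kphi] := K0 n.
  exact: le_trans (I_le _ _ Kphi) (Jc _ _ Kphi).
pose S := sup (range I_).
have IS n : I_ n <= S by apply: sup_upper_bound => //; exists n.
have e0 k : 0 < (8 ^+ k)^-1 :> R by rewrite invr_gt0 exprn_gt0.
have /choice[N HN] : forall k, exists n, S - (8 ^+ k)^-1 < I_ n.
  by move=> k; have [_ [n _ <-] h] := sup_adherent (e0 k) Isup; exists n.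
(* Indices that are nondecreasing and dominate both [N k] and [k]. *)
pose N' k := (\sum_(i < k.+1) N i + k)%N.
have N'N k : (N k <= N' k)%N.
  by rewrite /N' big_ord_recr/= -addnA addnCA leq_addr.
have N'S k : (N' k <= N' k.+1)%N.
  by rewrite /N' [in leqRHS]big_ord_recr/= -addnA leq_add// addnS ltnW// ltnS leq_addl.
have /choice[h Hh] : forall k, exists h, K (N' k) h /\ J h < S + (8 ^+ k)^-1.
  move=> k; have [_ [phi Kphi <-] hphi] := inf_adherent (e0 k) (hasinf (N' k)).
  exists phi; split => //; apply: lt_le_trans hphi _.
  by rewrite lerD2r; exact: IS.
have Kh k : K k (h k) by apply: Kle (Hh k).1; exact: leq_addl.
exists h; split=> //.
pose a k j x : R := (1 + h k j x)^-1.
have ma k j : measurable_fun setT (a k j).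
  by have /integrableP[/measurable_EFinP] := int _ _ j (Kh k).
have sqint k j : nu.-integrable setT (EFin \o (fun x => (a k j x - a k.+1 j x) ^+ 2)).
  apply: measurable_bounded_integrable => //.
    by apply: measurable_funX; apply: measurable_funB.
  exists 1; split; first exact: num_real.
  move=> M M1 x _ /=; apply: le_trans (ltW M1).
  rewrite ger0_norm ?sqr_ge0//.
  have ba i : 0 <= a i j x <= 1.
    have := Kge _ _ j x (Kh i) => hx.
    by rewrite invr_ge0 addr_ge0//= invf_le1 ?lerDl// ltr_pwDl.
  have := ba k; have := ba k.+1; move: (a k j x) (a k.+1 j x) => p q /andP[p0 p1] /andP[q0 q1].
  nra.
(* The midpoint of [h k] and [h k.+1] is in [K (N' k)] and cannot beat the infimum. *)
have step k : \sum_j \int[nu]_x (a k j x - a k.+1 j x) ^+ 2 <= 8 * (8 ^+ k)^-1.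
  have Kk1 : K (N' k) (h k.+1) by apply: Kle (Hh k.+1).1.
  have Km' := Kmid _ _ _ (Hh k).1 Kk1.
  pose m j x := (h k j x + h k.+1 j x) / 2.
  have intC j := int _ _ j Km'.
  apply: (@le_trans _ _ (4 * ((J (h k) + J (h k.+1)) / 2 - J m))); last first.
    have h1 := (Hh k).2; have h2 := (Hh k.+1).2.
    have h3 : S - (8 ^+ k)^-1 <= J m.
      by apply: le_trans (I_le _ _ Km'); apply: le_trans (ltW (HN k)) (Ind _ _ _).
    have h4 : (8 ^+ k.+1)^-1 <= (8 ^+ k)^-1 :> R.
      by rewrite lef_pV2 ?posrE ?exprn_gt0// exprS ler_peMl ?exprn_ge0// ler1n.
    move: (e0 k) h1 h2 h3 h4; set A := (8 ^+ k)^-1; set A' := (8 ^+ k.+1)^-1.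
    lra.
  have -> : 4 * ((J (h k) + J (h k.+1)) / 2 - J m) =
    \sum_j \int[nu]_x (4 * ((a k j x + a k.+1 j x) / 2 - (1 + m j x)^-1)).
    rewrite /J -big_split/= mulr_suml -sumrB mulr_sumr; apply: eq_bigr => j _.
    have i1 := int _ _ j (Kh k); have i2 := int _ _ j (Kh k.+1).
    have i12 : nu.-integrable setT (EFin \o (fun x => a k j x + a k.+1 j x)).
      exact: (integrableD measurableT i1 i2).
    have i12' : nu.-integrable setT (EFin \o (fun x => (a k j x + a k.+1 j x) / 2)).
      have -> : EFin \o (fun x => (a k j x + a k.+1 j x) / 2) =
         (fun x => (2^-1)%:E * (a k j x + a k.+1 j x)%R%:E)%E.
        by apply/funext => x; rewrite /= -EFinM mulrC.
      exact: integrableZl.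
    rewrite RintegralZl//; last exact: (integrableB measurableT i12' (intC j)).
    rewrite RintegralB//; last exact: intC.
    rewrite RintegralZr// RintegralD//.
  apply: ler_sum => j _.
  apply: le_Rintegral => //.
    have -> : EFin \o (fun x => 4 * ((a k j x + a k.+1 j x) / 2 - (1 + m j x)^-1)) =
      (fun x => 4%:E * ((a k j x + a k.+1 j x) / 2 - (1 + m j x)^-1)%R%:E)%E.
      by [].
    apply: integrableZl => //.
    have i1 := int _ _ j (Kh k); have i2 := int _ _ j (Kh k.+1).
    have hB := integrableB measurableT (integrableZl measurableT 2^-1
      (integrableD measurableT i1 i2)) (intC j).
    apply: eq_integrable hB => // x _.
    by rewrite /=; congr (_%:E); rewrite (mulrC (a k j x + _)).
  by move=> x _; apply: inv1D_midpoint; [exact: Kge (Kh k)|exact: Kge (Kh k.+1)].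
suff H j : {ae nu, forall x, cvgn (fun n => a n j x)}.
  exact: ae_forall_finType.
(* The factor [4 ^+ n] against the rate [8 ^- n] forces geometric increments. *)
pose g x := (\sum_(n <oo) (4 ^+ n * (a n j x - a n.+1 j x) ^+ 2)%:E)%E.
have sqm n : measurable_fun setT (fun x => (a n j x - a n.+1 j x) ^+ 2).
  by apply: measurable_funX; apply: measurable_funB.
have mg n : measurable_fun setT (fun x => (4 ^+ n * (a n j x - a n.+1 j x) ^+ 2)%:E).
  by apply/measurable_EFinP; apply: measurable_funM.
have g0 n x : (0 <= (4 ^+ n * (a n j x - a n.+1 j x) ^+ 2)%:E)%E.
  by rewrite lee_fin mulr_ge0 ?sqr_ge0 ?exprn_ge0.
have ig : (\int[nu]_x g x < +oo)%E.
  rewrite integral_nneseries//.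
  apply: (@le_lt_trans _ _ 16%:E); last exact: ltry.
  apply: le_trans (@epsilon_trick0 R 16 xpredT _) => //.
  apply: lee_nneseries => [n _ _|n _]; first exact: integral_ge0.
  under eq_integral do rewrite EFinM.
  rewrite ge0_integralZl//=; [|exact/measurable_EFinP|by move=> x _; rewrite lee_fin sqr_ge0].
  have -> : (\int[nu]_x ((a n j x - a n.+1 j x) ^+ 2)%:E =
     (\int[nu]_x (a n j x - a n.+1 j x) ^+ 2)%:E)%E.
    by rewrite /Rintegral fineK//; exact: (integrable_fin_num measurableT (sqint n j)).
  rewrite -EFinM lee_fin.
  have sj : \int[nu]_x (a n j x - a n.+1 j x) ^+ 2 <= 8 * (8 ^+ n)^-1.
    apply: le_trans (step n); rewrite (bigD1 j)//= lerDl sumr_ge0// => i _.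
    by apply: Rintegral_ge0 => x _; exact: sqr_ge0.
  apply: (@le_trans _ _ (4 ^+ n * (8 * (8 ^+ n)^-1))).
    by rewrite ler_wpM2l ?exprn_ge0.
  have -> : 8 ^+ n = 4 ^+ n * 2 ^+ n :> R by rewrite -exprMn -natrM.
  rewrite natrX exprS le_eqVlt; apply/orP; left; apply/eqP.
  by field; rewrite !expf_neq0.
have gint : nu.-integrable setT g.
  apply/integrableP; split.
    by apply: ge0_emeasurable_sum => // n x _ _; exact: g0.
  under eq_integral do rewrite gee0_abs ?nneseries_ge0//.
  exact: ig.
apply: filterS (integrable_ae measurableT gint) => x gx.
apply: cvgn_weighted_increments.
by have := gx Logic.I; rewrite ge0_fin_numE// nneseries_ge0.
Qed.

End ConvexCompactness.

(** * Limits of powers, products and reciprocals *)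

Section RealLimits.
Context {R : realType}.

Lemma cvg_powR (u : nat -> R) (v t : R) : 0 < t -> (forall n, 0 <= u n) ->
  u n @[n --> \oo] --> v -> u n `^ t @[n --> \oo] --> v `^ t.
Proof.
move=> t0 u0 uv.
have v0 : 0 <= v.
  by rewrite -(cvg_lim _ uv)//; apply: limr_ge; [exact: cvgP uv|exact: nearW].
move: v0; rewrite le_eqVlt => /predU1P[v0|v0]; last first.
  have h : expR (t * ln (u n)) @[n --> \oo] --> v `^ t.
    rewrite /powR gt_eqF//; apply: continuous_cvg; first exact: continuous_expR.
    apply: cvgM; first exact: cvg_cst.
    by apply: continuous_cvg uv; exact: continuous_ln.
  apply: cvg_trans h; apply: near_eq_cvg.
  have := uv; move=> /cvgrPdist_lt/(_ _ v0); apply: filterS => n.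
  rewrite ltr_distlC subrr => /andP[un0 _].
  by rewrite /powR gt_eqF.
rewrite -v0 powR0 ?gt_eqF//; apply/cvgrPdist_lt => e e0.
have e0' : 0 < e `^ t^-1 by rewrite powR_gt0.
have := uv; rewrite -v0 => /cvgrPdist_lt/(_ _ e0'); apply: filterS => n.
rewrite !sub0r !normrN !ger0_norm ?powR_ge0// => h.
rewrite (lt_le_trans (gt0_ltr_powR t0 _ _ h)) ?nnegrE ?powR_ge0//.
by rewrite -powRrM mulVf ?gt_eqF// powRr1// ltW.
Qed.

Lemma cvg_prod_seq (I : Type) (r : seq I) (u : nat -> I -> R) (v : I -> R) :
  (forall j, u n j @[n --> \oo] --> v j) ->
  \prod_(j <- r) u n j @[n --> \oo] --> \prod_(j <- r) v j.
Proof.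
move=> uv; elim: r => [|j r ih].
  by rewrite big_nil; under eq_fun do rewrite big_nil; exact: cvg_cst.
by rewrite big_cons; under eq_fun do rewrite big_cons; exact: cvgM.
Qed.

Lemma limn_einf_le (u : nat -> \bar R) c :
  (forall n, u n <= c)%E -> (limn_einf u <= c)%E.
Proof.
move=> uc; rewrite limn_einf_lim; apply: lime_le; first exact: is_cvg_einfs.
by apply: nearW => n; apply: le_trans (uc n); apply: ereal_inf_lbound; exists n => /=.
Qed.

Lemma inv1D_cvg_cases (u : nat -> R) : (forall n, 0 <= u n) ->
  cvgn (fun n => (1 + u n)^-1) ->
  cvgn u \/ u n @[n --> \oo] --> +oo.
Proof.
move=> u0 /cvg_ex[l /= ul].
have U0 n : 0 < (1 + u n)^-1 by rewrite invr_gt0 ltr_pwDl.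
have l0 : 0 <= l.
  rewrite -(cvg_lim _ ul)//; apply: limr_ge; first exact: cvgP ul.
  by apply: nearW => n; exact: ltW.
move: l0; rewrite le_eqVlt => /predU1P[l0|l0]; [right|left].
  apply/cvgryPge => A.
  have A0 : 0 < (1 + `|A|)^-1 by rewrite invr_gt0 ltr_pwDl.
  have := ul; rewrite -l0 => /cvgrPdist_lt/(_ _ A0); apply: filterS => n.
  have p1 : 0 < 1 + u n by rewrite ltr_pwDl.
  have p2 : 0 < 1 + `|A| by rewrite ltr_pwDl.
  rewrite sub0r normrN gtr0_norm// ltf_pV2 ?posrE//.
  by rewrite ltrD2l => h; apply: le_trans (ler_norm _) (ltW h).
have -> : u = (fun n => ((1 + u n)^-1)^-1 - 1).
  by apply/funext => n; rewrite invrK addrC addKr.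
apply: is_cvgB; last exact: is_cvg_cst.
by apply/cvg_ex; exists l^-1; apply: cvgV => //; rewrite gt_eqF.
Qed.

Lemma measurable_inv_ge0 d (X : measurableType d) (f : X -> R) :
  (forall x, 0 <= f x) -> measurable_fun setT f ->
  measurable_fun setT (fun x => (f x)^-1).
Proof.
move=> f0 mf; have -> : (fun x => (f x)^-1) = (fun x => f x `^ (-1)).
  by apply/funext => x; rewrite powR_inv1.
exact: (@measurableT_comp _ _ _ _ _ _ (@powR R ^~ (-1))).
Qed.

End RealLimits.

(** * Factorisation for products of convex sets *)

Section Factorisation.
Context {R : realType} {d : measure_display} {X : measurableType d}.
Variable mu : {measure set X -> \bar R}.
Hypothesis sf : sigma_finite setT mu.
Variables (I : finType) (theta : I -> R) (G : I -> set (X -> R)) (A : R).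

Definition gmean (v : I -> R) : R := \prod_j v j `^ theta j.

Hypothesis theta0 : forall j, 0 < theta j.
Hypothesis theta1 : \sum_j theta j = 1.
Hypothesis Gm : forall j g, G j g -> measurable_fun setT g.
Hypothesis Gge : forall j g x, G j g -> 0 <= g x.
Hypothesis G0 : forall j, G j (fun=> 0).
Hypothesis Gconvex : forall j g h t, G j g -> G j h -> 0 <= t <= 1 ->
  G j (fun x => (1 - t) * g x + t * h x).
Hypothesis Gsat : forall j E, measurable E -> (0 < mu E)%E ->
  exists E', [/\ measurable E', E' `<=` E, (0 < mu E')%E &
    exists2 g, G j g & forall x, E' x -> 0 < g x].
Hypothesis Gprod : forall g : I -> X -> R, (forall j, G j (g j)) ->
  (\int[mu]_x (gmean (g^~ x))%:E <= A%:E)%E.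

Let theta_le1 j : theta j <= 1.
Proof. by rewrite -theta1 (bigD1 j)//= lerDl sumr_ge0// => i _; exact: ltW. Qed.

Lemma measurable_gmean (f : I -> X -> R) : (forall j, measurable_fun setT (f j)) ->
  measurable_fun setT (fun x => gmean (f^~ x)).
Proof.
move=> mf; apply: measurable_prod => j _.
exact: (@measurableT_comp _ _ _ _ _ _ (@powR R ^~ (theta j))).
Qed.

Lemma gmean_ge0 (v : I -> R) : 0 <= gmean v.
Proof. by apply: prodr_ge0 => j _; exact: powR_ge0. Qed.

Lemma joint_saturation E : measurable E -> (0 < mu E)%E ->
  exists E', [/\ measurable E', E' `<=` E, (0 < mu E')%E &
    exists g : I -> X -> R, forall j, G j (g j) /\ forall x, E' x -> 0 < g j x].
Proof.
move=> mE E0.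
have : forall s : seq I, exists E', [/\ measurable E', E' `<=` E, (0 < mu E')%E &
    forall j, exists g, G j g /\ (j \in s -> forall x, E' x -> 0 < g x)].
  elim=> [|j s [E' [mE' E'E E'0 ih]]].
    by exists E; split => // j; exists (fun=> 0).
  have [F [mF FE' F0 [g Gg g0]]] := Gsat j mE' E'0.
  exists F; split=> //; first exact: subset_trans E'E.
  move=> i; have [->|ij] := eqVneq i j; first by exists g.
  have [k [Gk k0]] := ih i; exists k; split=> //.
  by rewrite inE (negbTE ij)/= => /k0 h x /FE'; exact: h.
move=> /(_ (enum I))[E' [mE' E'E E'0 /choice[g Hg]]].
exists E'; split=> //; exists g => j; split; first exact: (Hg j).1.
by apply: (Hg j).2; rewrite mem_enum.
Qed.

(** The dyadic weights sum to less than one, and [G j] is convex and contains zero. *)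
Lemma dyadic_sum_in_convex j K (g : nat -> X -> R) : (forall k, G j (g k)) ->
  G j (fun x => \sum_(k < K) (2 ^+ k.+1)^-1 * g k x).
Proof.
elim: K g => [|K ih] g Gg.
  have -> : (fun x => \sum_(k < 0) (2 ^+ k.+1)^-1 * g k x) = fun=> 0.
    by apply/funext => x; rewrite big_ord0.
  exact: G0.
have half : 0 <= (2^-1 : R) <= 1.
  by apply/andP; split; lra.
have := Gconvex (Gg 0%N) (ih (fun k => g k.+1) (fun k => Gg k.+1)) half.
congr (G _); apply/funext => x; rewrite big_ord_recl expr1; congr (_ * _ + _).
  by field.
rewrite mulr_sumr; apply: eq_bigr => k _.
by rewrite lift0 [2 ^+ k.+2]exprS invfM mulrA.
Qed.

(** The sets [E n] exhaust the space and [g0 j] is a small multiple of [gE n j] on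
    [E n]. Added to every competitor, [g0] keeps the weights [gmean a / a j] below
    well defined and lets truncations disappear in the limit. On finitely many of
    the [E n], [g + g0] is at most twice a member of [G]: hence the bound
    [2 * A]. *)
Lemma positive_minorant : exists (E : nat -> set X) (gE : nat -> I -> X -> R)
    (g0 : I -> X -> R),
  [/\ {ae mu, forall x, (\bigcup_n E n) x},
      forall n j, G j (gE n j) /\ forall x, E n x -> 0 < gE n j x,
      forall j, measurable_fun setT (g0 j) /\ forall x, 0 <= g0 j x,
      forall j x, (\bigcup_n E n) x -> 0 < g0 j x &
      forall g, (forall j, G j (g j)) ->
        (\int[mu]_x (gmean (fun j => g j x + g0 j x))%:E <= (2 * A)%:E)%E].
Proof.
pose P E := exists g : I -> X -> R, forall j, G j (g j) /\ forall x, E x -> 0 < g j x.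
have [||E mE0 Eh|E [mE PE tE EN]] := @exhaustion R d X mu P sf.
- by exists (fun _ _ => 0) => j.
- by move=> A' B _ AB [g Hg]; exists g => j; split=> [|x /AB]; case: (Hg j) => // _; apply.
- exact: joint_saturation.
have /choice[gE HgE] := PE.
pose w k : R := (2 ^+ k.+1)^-1.
have w0 k : 0 < w k by rewrite invr_gt0 exprn_gt0.
pose f j k x := w k * (\1_(E k) x * gE k j x).
have gE0 k j x : 0 <= gE k j x by apply: Gge; exact: (HgE k j).1.
have f0 j k x : 0 <= f j k x.
  by apply: mulr_ge0; [exact: ltW|apply: mulr_ge0 => //; rewrite indicE].
have fE j n x : E n x -> (\sum_(k <oo) (f j k x)%:E = (w n * gE n j x)%:E)%E.
  move=> Enx; have fk k : k != n -> f j k x = 0.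
    move=> kn; rewrite /f indicE memNset ?mul0r ?mulr0// => Ekx.
    move/trivIsetP : tE => /(_ k n Logic.I Logic.I kn)/seteqP[h _].
    exact: h x (conj Ekx Enx).
  rewrite (@nneseries_split_cond R _ 0 n.+1 xpredT); last by move=> k _; rewrite lee_fin.
  rewrite add0n ereal_series_cond eseries0 ?adde0; last first.
    by move=> k _ /andP[nk _]; rewrite fk// gtn_eqF.
  rewrite big_mkcond/= big_nat_recr//= big_nat big1 ?add0e => [|k /andP[_ kn]]; last first.
    by rewrite fk// ltn_eqF.
  by rewrite /f indicE mem_set// mul1r.
pose g0 j x := fine (\sum_(k <oo) (f j k x)%:E)%E.
have g0E j n x : E n x -> g0 j x = w n * gE n j x.
  by move=> Enx; rewrite /g0 (fE _ n).
have mf j k : measurable_fun setT (f j k).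
  apply: measurable_funM => //; apply: measurable_funM.
    exact: measurable_indic.
  exact: Gm (HgE k j).1.
have mg0 j : measurable_fun setT (g0 j).
  apply: (@measurableT_comp _ _ _ _ _ _ (@fine R)); first exact: fine_measurable.
  by apply: ge0_emeasurable_sum => [k x _ _|k _]; rewrite ?lee_fin//; exact/measurable_EFinP.
have g0ge j x : 0 <= g0 j x.
  by apply: fine_ge0; apply: nneseries_ge0 => k _ _; rewrite lee_fin.
exists E, gE, g0; split=> // [|j x [n _ Enx]|g Gg].
  exists (~` \bigcup_n E n); split=> //.
  by apply: measurableC; exact: bigcupT_measurable.
  by rewrite (g0E _ n)// mulr_gt0//; exact: (HgE n j).2.
pose F K := \big[setU/set0]_(k < K.+1) E k.
have FU : \bigcup_n E n = \bigcup_K F K by rewrite bigcup_bigsetU_bigcup.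
have mF K : measurable (F K) by apply: bigsetU_measurable.
pose a x := gmean (fun j => g j x + g0 j x).
have ma : measurable_fun setT a.
  by apply: measurable_gmean => j; apply: measurable_funD => //; exact: Gm (Gg j).
have a0 x : (0 <= (a x)%:E)%E by rewrite lee_fin gmean_ge0.
have bnd K : (\int[mu]_(x in F K) (a x)%:E <= (2 * A)%:E)%E.
  pose q j x := (1 - 2^-1) * g j x + 2^-1 * \sum_(k < K.+1) w k * gE k j x.
  have Gq j : G j (q j).
    apply: Gconvex => //; last by apply/andP; split; lra.
    exact: (@dyadic_sum_in_convex j K.+1 (fun k => gE k j) (fun k => (HgE k j).1)).
  have mq : measurable_fun setT (fun x => gmean (q^~ x)).
    by apply: measurable_gmean => j; exact: Gm (Gq j).
  apply: (@le_trans _ _ (\int[mu]_(x in F K) (2%:E * (gmean (q^~ x))%:E))%E).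
    apply: ge0_le_integral => //.
    - by apply/measurable_EFinP; exact: measurable_funTS.
    - by apply: measurable_funeM; apply/measurable_EFinP; exact: measurable_funTS.
    - move=> x; rewrite /F -bigcup_mkord => -[k /= kK Ekx]; rewrite -EFinM lee_fin.
      have -> : 2 * gmean (q^~ x) = gmean (fun j => 2 * q j x).
        transitivity (\prod_j (2 `^ theta j * q j x `^ theta j)).
          by rewrite big_split/= powR_sum_exp// theta1 powRr1.
        by apply: eq_bigr => j _; rewrite powRM//; exact: Gge (Gq j).
      apply: ler_prod => j _; rewrite powR_ge0/=; apply: ler_powR2r.
      + exact: ltW.
      + by rewrite addr_ge0//; exact: Gge (Gg j).
      + have -> : 2 * q j x = g j x + \sum_(k < K.+1) w k * gE k j x by rewrite /q; field.
        rewrite lerD2l (g0E _ k)// (bigD1 (Ordinal kK))//= lerDl sumr_ge0// => i _.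
        by rewrite mulr_ge0// ltW.
  rewrite ge0_integralZl//; [|by apply/measurable_EFinP; exact: measurable_funTS|
    by move=> x _; rewrite lee_fin gmean_ge0].
  rewrite EFinM lee_pmul2l//; apply: le_trans (Gprod Gq).
  apply: ge0_subset_integral => //; first exact/measurable_EFinP.
  by move=> x _; rewrite lee_fin gmean_ge0.
have -> : (\int[mu]_x (a x)%:E = \int[mu]_(x in \bigcup_K F K) (a x)%:E)%E.
  rewrite (@ge0_negligible_integral _ _ _ mu setT (~` \bigcup_n E n))//.
  - by rewrite setTD setCK FU.
  - by apply: measurableC; exact: bigcupT_measurable.
  - exact/measurable_EFinP.
have ndF : nondecreasing_seq F.
  by move=> m n mn; apply/subsetPset; exact: subset_bigsetU.
have := @ge0_nondecreasing_set_cvg_integral _ _ _ F (EFin \o a) mu ndF mF.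
move=> /(_ _ _)/cvg_lim <-//; last 2 first.
- by move=> i; apply/measurable_EFinP; exact: measurable_funTS.
- by move=> i x _; exact: a0.
apply: lime_le; last by apply: nearW => K; exact: bnd.
apply: ereal_nondecreasing_is_cvgn.
apply: ge0_nondecreasing_set_nondecreasing_integral => //.
- by move=> i; apply/measurable_EFinP; exact: measurable_funTS.
- by move=> i x _; exact: a0.
Qed.

(** Weights with the required properties, up to a truncation that weakens as [n]
    grows. *)
Let competitor_family (phi : I -> X -> R) (g0 : I -> X -> R) (n : nat) : Prop :=
  [/\ forall j, measurable_fun setT (phi j), forall j x, 0 <= phi j x,
      {ae mu, forall x, 1 <= gmean (phi^~ x)} &
      forall j h, G j h ->
        (\int[mu]_x (if h x <= 2 ^+ n * g0 j x then h x * phi j x else 0)%:E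
         <= (8 / theta j * A)%:E)%E].

Let measurable_truncated (h f g : X -> R) :
  measurable_fun setT h -> measurable_fun setT f -> measurable_fun setT g ->
  measurable_fun setT (fun x => (if h x <= f x then g x else 0)%:E).
Proof.
move=> mh mf mg; apply/measurable_EFinP; apply: measurable_fun_ifT => //.
exact: measurable_fun_ler.
Qed.

(** First-order optimality at a near-maximiser [a = g + g0] of the geometric mean
    integral, tested by moving one coordinate a distance [2 ^- n] towards [h]: the
    weight [gmean a / a j] is the gradient, up to the factor [theta j]. *)
Lemma near_maximiser_weights (g0 : I -> X -> R) (n : nat) :
  (forall j, measurable_fun setT (g0 j) /\ forall x, 0 <= g0 j x) ->
  {ae mu, forall x, forall j, 0 < g0 j x} ->
  (forall g, (forall j, G j (g j)) ->
    (\int[mu]_x (gmean (fun j => g j x + g0 j x))%:E <= (2 * A)%:E)%E) ->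
  exists phi, competitor_family phi g0 n.
Proof.
move=> Hg0 g0pos bnd.
have g0ge j x : 0 <= g0 j x by exact: (Hg0 j).2.
have mg0 j : measurable_fun setT (g0 j) by exact: (Hg0 j).1.
pose V := [set v : \bar R | exists2 g : I -> X -> R, (forall j, G j (g j)) &
  v = (\int[mu]_x (gmean (fun j => g j x + g0 j x))%:E)%E].
have int0 (g : I -> X -> R) :
    (0 <= \int[mu]_x (gmean (fun j => g j x + g0 j x))%:E)%E.
  by apply: integral_ge0 => x _; rewrite lee_fin gmean_ge0.
have V2A : (ereal_sup V <= (2 * A)%:E)%E by apply: ge_ereal_sup => _ [g Gg ->]; exact: bnd.
have V0 : (0 <= ereal_sup V)%E.
  apply: (@le_trans _ _ (\int[mu]_x (gmean (fun j => 0 + g0 j x))%:E)%E).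
    exact: (int0 (fun _ _ => 0)).
  by apply: ereal_sup_ubound; exists (fun _ _ => 0).
have Vfin : ereal_sup V \is a fin_num.
  by rewrite ge0_fin_numE// (le_lt_trans V2A)// ltry.
pose M := fine (ereal_sup V).
have ME : ereal_sup V = M%:E by rewrite /M fineK.
have M0 : 0 <= M by rewrite fine_ge0.
have M2A : M <= 2 * A by rewrite -lee_fin -ME.
pose t : R := (2 ^+ n)^-1.
have t0 : 0 < t by rewrite invr_gt0 exprn_gt0.
have t1 : t <= 1 by rewrite invf_le1 ?exprn_gt0// exprn_ege1// ler1n.
(* The defect is proportional to [M], so that it costs a constant factor only;
   for [M = 0] every [g] is a maximiser. *)
have [g Gg gM] : exists2 g : I -> X -> R, (forall j, G j (g j)) &
    ((M - t * M)%:E <= \int[mu]_x (gmean (fun j => g j x + g0 j x))%:E)%E.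
  move: (M0); rewrite le_eqVlt => /predU1P[<-|Mgt0].
    by exists (fun _ _ => 0) => //; rewrite mulr0 subr0; exact: int0.
  have tM : 0 < t * M by rewrite mulr_gt0.
  have [_ [g Gg ->] h] := ub_ereal_sup_adherent tM Vfin.
  by exists g => //; rewrite EFinB -ME; exact: ltW.
pose a j x := g j x + g0 j x.
have age j x : 0 <= a j x by rewrite addr_ge0//; exact: Gge (Gg j).
have ma j : measurable_fun setT (a j) by apply: measurable_funD => //; exact: Gm (Gg j).
have [P PE] : exists P : X -> R, P = fun x => gmean (a^~ x) by eexists.
have P0 x : 0 <= P x by rewrite PE; exact: gmean_ge0.
have mP : measurable_fun setT P by rewrite PE; exact: measurable_gmean.
have mPE : measurable_fun setT (EFin \o P) by exact/measurable_EFinP.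
pose phi j x := P x / a j x.
have mphi j : measurable_fun setT (phi j).
  by apply: measurable_funM => //; exact: measurable_inv_ge0.
have phi0 j x : 0 <= phi j x by rewrite divr_ge0.
exists phi; split=> //.
  apply: filterS g0pos => x gx.
  have ap j : 0 < a j x by rewrite ltr_pwDr//; exact: Gge (Gg j).
  have Pp : 0 < P x by rewrite PE; apply: prodr_gt0 => j _; rewrite powR_gt0.
  rewrite /gmean (eq_bigr (fun j => P x `^ theta j / a j x `^ theta j)); last first.
    by move=> j _; exact: powR_div.
  rewrite prodf_div powR_sum_exp// theta1 (powRr1 (ltW Pp)).
  by rewrite -[X in _ / X]/(gmean (a^~ x)) -[gmean _]/((fun x => gmean (a^~ x)) x) -PE divff// gt_eqF.
move=> j h Gh.
have h0 x : 0 <= h x by exact: Gge Gh.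
have mh : measurable_fun setT h by exact: Gm Gh.
have [tr trE] : exists tr : X -> R, tr = fun x =>
    if h x <= 2 ^+ n * g0 j x then h x * phi j x else 0 by eexists.
have tr0 x : 0 <= tr x by rewrite trE; case: ifP => // _; rewrite mulr_ge0.
have mtr : measurable_fun setT (EFin \o tr).
  by rewrite trE; apply: measurable_truncated => //; exact: measurable_funM.
pose g' i := if i == j then (fun x => (1 - t) * g j x + t * h x) else g i.
have Gg' i : G i (g' i).
  rewrite /g'; case: eqVneq => // ->; apply: Gconvex => //.
  by rewrite t1 ltW.
have up : (\int[mu]_x (gmean (fun j => g' j x + g0 j x))%:E <= M%:E)%E.
  by rewrite -ME; apply: ereal_sup_ubound; exists g'.
have t1' : 0 <= 1 - t by rewrite subr_ge0.
have th2 : 0 <= theta j / 2 * t by rewrite mulr_ge0// ?divr_ge0// ltW.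
have low : ((1 - t)%:E * \int[mu]_x (P x)%:E + (theta j / 2 * t)%:E * \int[mu]_x (tr x)%:E
    <= M%:E)%E.
  apply: le_trans up.
  have P0' x : [set: X] x -> (0 <= (P x)%:E)%E by rewrite lee_fin.
  have tr0' x : [set: X] x -> (0 <= (tr x)%:E)%E by rewrite lee_fin.
  rewrite -(@ge0_integralZl_EFin _ _ _ mu setT measurableT _ P0' mPE _ t1').
  rewrite -(@ge0_integralZl_EFin _ _ _ mu setT measurableT _ tr0' mtr _ th2).
  rewrite -(@ge0_integralD _ _ _ mu setT measurableT); last 4 first.
  - by move=> x Dx; apply: mule_ge0; [rewrite lee_fin|exact: P0'].
  - exact: measurable_funeM.
  - by move=> x Dx; apply: mule_ge0; [rewrite lee_fin|exact: tr0'].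
  - exact: measurable_funeM.
  apply: ae_ge0_le_integral => //.
  - move=> x Dx; apply: adde_ge0; apply: mule_ge0; rewrite ?lee_fin//.
  - by apply: emeasurable_funD; exact: measurable_funeM.
  - by move=> x _; rewrite lee_fin gmean_ge0.
  - apply/measurable_EFinP; apply: measurable_gmean => i.
    by apply: measurable_funD => //; exact: Gm (Gg' i).
  apply: filterS g0pos => x gx _; rewrite -!EFinM -EFinD lee_fin.
  have ap : 0 < a j x by rewrite ltr_pwDr//; exact: Gge (Gg j).
  pose u := h x / a j x.
  have u0 : 0 <= u by rewrite divr_ge0.
  have th01 : 0 < theta j <= 1 by rewrite theta0 theta_le1.
  have t01 : 0 < t <= 1 by rewrite t0 t1.
  have y0 : 0 <= 1 - t + t * u by rewrite addr_ge0// mulr_ge0// ltW.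
  apply: (@le_trans _ _ (P x * (1 - t + t * u) `^ theta j)); last first.
    rewrite PE /gmean (bigD1 j)//= mulrAC -powRM// [leRHS](bigD1 j)//=.
    have -> : \prod_(i | i != j) (g' i x + g0 i x) `^ theta i
        = \prod_(i | i != j) a i x `^ theta i.
      by apply: eq_bigr => i ij; rewrite /g' (negbTE ij).
    rewrite ler_wpM2r//; first by apply: prodr_ge0 => i _; exact: powR_ge0.
    apply: ler_powR2r; first exact: ltW.
      by rewrite mulr_ge0.
    rewrite /g' eqxx; set L := (X in X <= _).
    have -> : L = (1 - t) * a j x + t * h x.
      by rewrite /L /u; field; rewrite gt_eqF.
    rewrite /a.
    have := mulr_ge0 (ltW t0) (g0ge j x); nra.
  rewrite trE; case: ifPn => [hg|_].
    have tu1 : t * u <= 1.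
      rewrite /u mulrA ler_pdivrMr// mul1r /t mulrC ler_pdivrMr ?exprn_gt0//.
      rewrite mulrC; apply: le_trans hg _; rewrite ler_wpM2l ?exprn_ge0//.
      by rewrite /a lerDr; exact: Gge (Gg j).
    have := ler_wpM2l (P0 x) (perturbation_lower_bound th01 t01 u0 tu1).
    apply: le_trans; rewrite /phi /u le_eqVlt; apply/orP; left; apply/eqP; ring.
  rewrite mulr0 addr0 mulrC ler_wpM2l//.
  exact: perturbation_lower_bound0.
have low2 : (((1 - t) * (M - t * M))%:E + (theta j / 2 * t)%:E * \int[mu]_x (tr x)%:E
    <= M%:E)%E.
  apply: le_trans low; rewrite leeD2r// EFinM; apply: lee_wpmul2l.
    by rewrite lee_fin.
  by apply: le_trans gM _; rewrite PE.
have W0 : (0 <= \int[mu]_x (tr x)%:E)%E by apply: integral_ge0 => x _; rewrite lee_fin.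
have c0 : 0 < theta j / 2 * t by rewrite mulr_gt0// divr_gt0.
apply: (@le_trans _ _ (4 / theta j * M)%:E); last first.
  rewrite lee_fin; have -> : 8 / theta j * A = 4 / theta j * (2 * A) by field; rewrite gt_eqF.
  by rewrite ler_wpM2l// divr_ge0// ltW.
rewrite -[X in (X <= _)%E](_ : (\int[mu]_x (tr x)%:E)%E = _); last by rewrite trE.
rewrite -(@lee_pmul2l _ (theta j / 2 * t)%:E)//.
have h3 : ((theta j / 2 * t)%:E * \int[mu]_x (tr x)%:E <= (M - (1 - t) * (M - t * M))%:E)%E.
  by rewrite EFinB leeBrDl.
apply: le_trans h3 _; rewrite -EFinM lee_fin.
have -> : theta j / 2 * t * (4 / theta j * M) = 2 * t * M by field; rewrite gt_eqF.
have := mulr_ge0 (mulr_ge0 (ltW t0) (ltW t0)) M0; nra.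
Qed.

(** A maximiser of the integral of the geometric mean need not exist, since the mass
    of a maximising sequence may concentrate. The admissible weights do have almost
    everywhere limits, by [convex_ae_cvg]; these are finite because [gE n j] is
    positive on [E n], and they inherit every bound by Fatou's lemma. *)
Theorem multilinear_duality : exists phi : I -> X -> R,
  [/\ forall j, measurable_fun setT (phi j), forall j x, 0 <= phi j x,
      {ae mu, forall x, 1 <= gmean (phi^~ x)} &
      forall j h, G j h ->
        (\int[mu]_x (h x * phi j x)%:E <= (8 / theta j * A)%:E)%E].
Proof.
have [E [gE [g0 [mE0 HgE Hg0 g0E bnd]]]] := positive_minorant.
have g0pos : {ae mu, forall x, forall j, 0 < g0 j x}.
  by apply: filterS mE0 => x Ex j; exact: g0E.
have g0ge j x : 0 <= g0 j x by exact: (Hg0 j).2.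
have mg0 j : measurable_fun setT (g0 j) by exact: (Hg0 j).1.
have [nu [nufin numu]] := sigma_finite_dominating sf.
pose K n : set (I -> X -> R) := fun phi => competitor_family phi g0 n.
have [|||||h [Kh hcvg]] := @convex_ae_cvg R d X nu nufin I K.
- move=> n phi [mphi phi0 phi1 phiG]; split=> // j h Gh.
  apply: le_trans (phiG j h Gh); apply: ge0_le_integral => //.
  + by move=> x _; rewrite lee_fin; case: ifP => // _; rewrite mulr_ge0//; exact: Gge Gh.
  + apply: measurable_truncated; [exact: Gm Gh|exact: measurable_funM|].
    by apply: measurable_funM => //; exact: Gm Gh.
  + apply: measurable_truncated; [exact: Gm Gh|exact: measurable_funM|].
    by apply: measurable_funM => //; exact: Gm Gh.
  + move=> x _; rewrite lee_fin; case: ifPn => [hg|_].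
      suff -> : h x <= 2 ^+ n.+1 * g0 j x by [].
      by apply: le_trans hg _; rewrite ler_wpM2r// ler_eXn2l// ltr1n.
    by case: ifP => // _; rewrite mulr_ge0//; exact: Gge Gh.
- by move=> n; exact: near_maximiser_weights.
- by move=> n phi j [].
- by move=> n phi j x [].
- move=> n phi psi [mphi phi0 phi1 phiG] [mpsi psi0 psi1 psiG]; split.
  + by move=> j; apply: measurable_funM => //; exact: measurable_funD.
  + by move=> j x; rewrite divr_ge0// addr_ge0.
  + apply: filterS2 phi1 psi1 => x h1 h2.
    (* Arithmetic means dominate geometric means coordinatewise. *)
    have h12 : 1 <= gmean (phi^~ x) * gmean (psi^~ x) by rewrite mulr_ege1.
    have : 1 <= (gmean (phi^~ x) * gmean (psi^~ x)) `^ 2^-1.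
      by have := ler_powR2r (_ : 0 <= 2^-1 :> R) ler01 h12; rewrite powR1; apply.
    move/le_trans; apply; rewrite /gmean -big_split/= powR_prod; last first.
      by move=> j; rewrite mulr_ge0 ?powR_ge0.
    apply: ler_prod => j _; rewrite powR_ge0/= -powRM// powRAC; apply: ler_powR2r.
    * exact: ltW.
    * exact: powR_ge0.
    * have := @weighted_AMGM R 2^-1 (phi j x) (psi j x).
      have -> : 1 - 2^-1 = 2^-1 :> R by field.
      rewrite -powRM// => h; apply: le_trans (h _ _ _) _ => //; last lra.
      by apply/andP; split; lra.
  + move=> j h Gh.
    have h0 x : 0 <= h x by exact: Gge Gh.
    have mh : measurable_fun setT h by exact: Gm Gh.
    pose tr (f : I -> X -> R) x := if h x <= 2 ^+ n * g0 j x then h x * f j x else 0.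
    have mtr f : measurable_fun setT (f j) -> measurable_fun setT (EFin \o tr f).
      by move=> mf; apply: measurable_truncated => //; exact: measurable_funM.
    have tr0 f : (forall x, 0 <= f j x) -> forall x, (0 <= (tr f x)%:E)%E.
      by move=> f0 x; rewrite lee_fin /tr; case: ifP => // _; rewrite mulr_ge0.
    have -> : (\int[mu]_x (if h x <= 2 ^+ n * g0 j x
          then h x * ((phi j x + psi j x) / 2) else 0)%:E
        = \int[mu]_x ((2^-1)%:E * ((tr phi x)%:E + (tr psi x)%:E)))%E.
      apply: eq_integral => x _; rewrite -EFinD -EFinM /tr; congr (_%:E).
      by case: ifP => _; field.
    rewrite ge0_integralZl//; [|by apply: emeasurable_funD; exact: mtr|
      by move=> x _; rewrite adde_ge0// tr0].
    rewrite ge0_integralD//; [|by move=> x _; exact: tr0|exact: mtr|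
      by move=> x _; exact: tr0|exact: mtr].
    have := leeD (phiG j h Gh) (psiG j h Gh).
    rewrite -[X in (X + _ <= _)%E]/(\int[mu]_x (tr phi x)%:E)%E.
    rewrite -[X in (_ + X <= _)%E]/(\int[mu]_x (tr psi x)%:E)%E => h2.
    apply: le_trans (lee_wpmul2l _ h2) _; first by rewrite lee_fin.
    by rewrite -EFinD -EFinM lee_fin le_eqVlt; apply/orP; left; apply/eqP; field; rewrite gt_eqF.
have hm n j : measurable_fun setT (h n j) by case: (Kh n).
have h0 n j x : 0 <= h n j x by case: (Kh n) => _ H _ _; exact: H.
have {}hcvg : {ae mu, forall x j, cvgn (fun n => h n j x) \/ h n j x @[n --> \oo] --> +oo}.
  have [N [mN N0 Nsub]] := hcvg; exists N; split=> //; first exact: numu.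
  move=> x /= nx; apply: Nsub => /= hx; apply: nx => j; exact: inv1D_cvg_cases.
pose tr j (g : X -> R) n x : R := if g x <= 2 ^+ n * g0 j x then g x * h n j x else 0.
have mtr j g n : G j g -> measurable_fun setT (EFin \o tr j g n).
  move=> Gg; apply: measurable_truncated; [exact: Gm Gg|exact: measurable_funM|].
  by apply: measurable_funM => //; exact: Gm Gg.
have tr0 j g n x : G j g -> (0 <= (tr j g n x)%:E)%E.
  by move=> Gg; rewrite lee_fin /tr; case: ifP => // _; rewrite mulr_ge0//; exact: Gge Gg.
have trE j g x : 0 < g0 j x -> \forall n \near \oo, tr j g n x = g x * h n j x.
  move=> gx; exists (Num.truncn (g x / g0 j x)).+1 => // n /= nk.
  rewrite /tr ifT// -ler_pdivrMr//; apply: le_trans (ltW (truncnS_gt _)) _.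
  by rewrite -natrX ler_nat (leq_trans nk)// ltnW// ltn_expl.
have fat j g : G j g ->
    (\int[mu]_x limn_einf (fun n => (tr j g n x)%:E) <= (8 / theta j * A)%:E)%E.
  move=> Gg; apply: le_trans (@fatou _ _ _ mu setT measurableT (fun n => EFin \o tr j g n) _ _) _.
  - by move=> n; exact: mtr.
  - by move=> n x _; exact: tr0.
  - apply: limn_einf_le => n; case: (Kh n) => _ _ _; exact.
have lte0 (u : nat -> \bar R) : (forall n, 0 <= u n)%E -> (0 <= limn_einf u)%E.
  move=> u0; rewrite limn_einf_lim; apply: lime_ge; first exact: is_cvg_einfs.
  by apply: nearW => n; apply: le_ereal_inf_tmp => _ [k _ <-]; exact: u0.
have meinf j g : G j g -> measurable_fun setT (fun x => limn_einf (fun n => (tr j g n x)%:E)).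
  move=> Gg; apply: measurableT_comp => //; apply: measurable_fun_limn_esup => n.
  by apply: measurableT_comp => //; exact: mtr.
have fin : {ae mu, forall x, forall j, cvgn (fun n => h n j x)}.
  have H : {ae mu, forall x, forall n j,
      limn_einf (fun k => (tr j (gE n j) k x)%:E) \is a fin_num}.
    apply: ae_foralln => n; apply: ae_forall_finType => j.
    have Gg := (HgE n j).1.
    suff /(integrable_ae measurableT) : mu.-integrable setT
        (fun x => limn_einf (fun k => (tr j (gE n j) k x)%:E)).
      by apply: filterS => x; apply.
    apply/integrableP; split; first exact: meinf.
    rewrite (eq_integral (fun x => limn_einf (fun k => (tr j (gE n j) k x)%:E))).
      by apply: le_lt_trans (fat j _ Gg) _; exact: ltry.
    by move=> x _; rewrite gee0_abs//; apply: lte0 => k; exact: tr0.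
  apply: filterS2 (filterI hcvg H) (filterI mE0 g0pos).
  move=> x [hx Hx] [[n _ Enx] gx] j.
  case: (hx j) => // hoo; exfalso.
  have c : (tr j (gE n j) k x)%:E @[k --> \oo] --> +oo%E.
    apply/cvgeryP; apply: (@cvg_trans _ (gE n j x * h k j x @[k --> \oo])).
      by apply: near_eq_cvg; apply: filterS (trE j (gE n j) x (gx j)).
    apply/cvgryPge => c; move/cvgryPge/(_ (c / gE n j x)) : hoo.
    by apply: filterS => k; rewrite ler_pdivrMr ?(HgE n j).2// mulrC.
  by have := Hx n j; rewrite (cvg_limn_einf_sup c).1.
pose phi j x := fine (limn_esup (fun n => (h n j x)%:E)).
have phiE : {ae mu, forall x j, h n j x @[n --> \oo] --> phi j x}.
  apply: filterS fin => x hx j; rewrite /phi.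
  have hx' : (h n j x)%:E @[n --> \oo] --> (limn (fun n => h n j x))%:E.
    by apply: cvg_EFin; [exact: nearW|exact: hx].
  by rewrite (cvg_limn_einf_sup hx').2/=; exact: hx.
have mphi j : measurable_fun setT (phi j).
  apply: (@measurableT_comp _ _ _ _ _ _ (@fine R)); first exact: fine_measurable.
  by apply: measurable_fun_limn_esup => n; exact/measurable_EFinP.
have phi0 j x : 0 <= phi j x.
  apply: fine_ge0; apply: le_trans (limn_einf_sup _).
  by apply: lte0 => n; rewrite lee_fin.
exists phi; split=> //.
- have h1 : {ae mu, forall x, forall n, 1 <= gmean (h n ^~ x)}.
    by apply: ae_foralln => n; case: (Kh n).
  apply: filterS2 phiE h1 => x hx h1.
  have c : gmean (h n ^~ x) @[n --> \oo] --> gmean (phi^~ x).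
    by apply: cvg_prod_seq => j; apply: cvg_powR.
  by rewrite -(cvg_lim _ c)//; apply: limr_ge; [exact: cvgP c|exact: nearW].
- move=> j g Gg; apply: le_trans (fat j g Gg).
  have g0' x : 0 <= g x by exact: Gge Gg.
  apply: ae_ge0_le_integral => //.
  + by move=> x _; rewrite lee_fin mulr_ge0.
  + apply/measurable_EFinP; apply: measurable_funM; first exact: Gm Gg.
    exact: mphi.
  + by move=> x _; apply: lte0 => n; exact: tr0.
  + exact: meinf.
  + apply: filterS2 phiE g0pos => x hx gx _.
    have c : (tr j g k x)%:E @[k --> \oo] --> (g x * phi j x)%:E.
      apply: cvg_EFin; first exact: nearW.
      apply: (@cvg_trans _ (g x * h k j x @[k --> \oo])).
        by apply: near_eq_cvg; apply: filterS (trE j g x (gx j)).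
      by apply: cvgM; [exact: cvg_cst|exact: hx].
    by rewrite (cvg_limn_einf_sup c).1.
Qed.

End Factorisation.

(** * The theorem *)

Section AveragedInequality.
Context {R : realType} {disp : measure_display} {X : measurableType disp}.
Variable mu : {measure set X -> \bar R}.
Context {s : scalar_kind} {I : finType} {Y : I -> lmodType (scalars R s)}.
Variables (T : forall j, Y j -> X -> scalars R s) (nrm : forall j, Y j -> R).
Variables (e : I -> R) (B : R).
Arguments T : clear implicits.
Arguments nrm : clear implicits.
Hypothesis T_lin : forall j, linear_operator mu (T j).
Hypothesis T_bound : forall f : (forall j, Y j),
  (\int[mu]_x (\prod_j modulus (T j (f j) x) `^ e j)%:E
   <= (B * \prod_j nrm j (f j) `^ e j)%:E)%E.

(** Expanding both products of sums turns the hypothesis on single functions into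
    its average over independent choices of one function from each list. *)
Lemma averaged_inequality (z : forall j, seq (R * Y j)) :
  (forall j i, 0 <= (nth (0, 0) (z j) i).1) ->
  (\int[mu]_x (\prod_j \sum_(a <- z j) a.1 * modulus (T j a.2 x) `^ e j)%:E
   <= (B * \prod_j \sum_(a <- z j) a.1 * nrm j a.2 `^ e j)%:E)%E.
Proof.
move=> z0; pose M := \max_j size (z j).
pose w (g : {ffun I -> 'I_M}) : R := \prod_j (nth (0, 0) (z j) (g j)).1.
pose f (g : {ffun I -> 'I_M}) j := (nth (0, 0) (z j) (g j)).2.
have w0 g : 0 <= w g by apply: prodr_ge0 => j _; exact: z0.
have expand (F : forall j, Y j -> R) :
    \prod_j \sum_(a <- z j) a.1 * F j a.2 = \sum_g w g * \prod_j F j (f g j).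
  have E j : \sum_(a <- z j) a.1 * F j a.2 =
      \sum_(i < M) (nth (0, 0) (z j) i).1 * F j (nth (0, 0) (z j) i).2.
    rewrite (big_nth (0, 0)) big_mkord.
    have zM : (size (z j) <= M)%N by apply: (leq_bigmax j).
    rewrite (big_ord_widen M (fun i => (nth (0, 0) (z j) i).1 * F j (nth (0, 0) (z j) i).2))//.
    rewrite big_mkcond/=; apply: eq_bigr => i _; case: ltnP => // zi.
    by rewrite nth_default//= mul0r.
  under eq_bigr do rewrite E.
  by rewrite bigA_distr_bigA/=; apply: eq_bigr => g _; rewrite big_split.
pose m g x := \prod_j modulus (T j (f g j) x) `^ e j.
have m0 g x : 0 <= m g x by apply: prodr_ge0 => j _; exact: powR_ge0.
have mm g : measurable_fun setT (m g).
  apply: measurable_prod => j _.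
  apply: (@measurableT_comp _ _ _ _ _ _ (@powR R ^~ (e j))) => //.
  exact: measurable_modulus.
rewrite (eq_integral (fun x => \sum_g (w g * m g x)%:E)%E); last first.
  by move=> x _; rewrite (expand (fun j y => modulus (T j y x) `^ e j)) sumEFin.
rewrite ge0_integral_sum//; last 2 first.
- by move=> g; apply/measurable_EFinP; exact: measurable_funM.
- by move=> g x _; rewrite lee_fin mulr_ge0.
rewrite (expand (fun j y => nrm j y `^ e j)) mulr_sumr -sumEFin.
apply: lee_sum => g _; under eq_integral do rewrite EFinM.
rewrite ge0_integralZl_EFin//; last 2 first.
- by move=> x _; rewrite lee_fin.
- exact/measurable_EFinP.
by rewrite mulrCA EFinM; apply: lee_wpmul2l; [rewrite lee_fin|exact: T_bound].
Qed.

End AveragedInequality.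

Section RademacherConstant.
Context {R : realType} {s : scalar_kind} {Y : lmodType (scalars R s)}.
Variables (nrm : Y -> R) (r : R).
Hypothesis nrm_qn : quasi_norm nrm.

Lemma modulus1 : modulus (1 : scalars R s) = 1.
Proof. by case: s => /=; [exact: normr1|exact: Normc.normc1]. Qed.

(** A single vector: its signed copies all have the same norm. *)
Lemma rademacher_bound_ge1 (c : R) (y : Y) : 0 < r -> 0 < nrm y ->
  rademacher_bound nrm r c -> 1 <= c.
Proof.
move=> r0 y0 /(_ 1%N (fun=> y)); have [_ _ nZ _] := nrm_qn.
have -> : rademacher_expectation (fun e : {ffun 'I_1 -> bool} =>
    nrm (\sum_(k < 1) (-1) ^+ e k *: y) `^ r) = nrm y `^ r.
  rewrite /rademacher_expectation (eq_bigr (fun=> nrm y `^ r)) => [|e _].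
    rewrite sumr_const card_ffun card_bool card_ord expn1 expr1.
    by rewrite -[_ *+ 2]mulr_natr mulfK.
  by rewrite big_ord1 nZ -[_ ^+ _]mulr1 modulus_sign modulus1 mul1r.
rewrite big_ord1 -powRrM divff ?gt_eqF// powRr1 ?(ltW y0)//.
by rewrite ler_pMl.
Qed.

Lemma rademacher_const_ge0 : 0 <= rademacher_const nrm r.
Proof.
have [[c Hc]|h] := pselect ([set c : R | 0 <= c /\ rademacher_bound nrm r c] !=set0).
  by apply: lb_le_inf; [exists c|move=> x []].
rewrite /rademacher_const (_ : [set _ | _] = set0) ?inf0//.
by apply/seteqP; split=> // x Hx; apply: h; exists x.
Qed.

Lemma rademacher_const_approx (y : Y) : 0 < r -> 0 < nrm y -> has_rademacher_type nrm r ->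
  exists c, [/\ 1 <= c, rademacher_bound nrm r c & c <= 2 * rademacher_const nrm r].
Proof.
move=> r0 y0 [c1 c10 Hc1].
set S := [set c : R | 0 <= c /\ rademacher_bound nrm r c].
have S0 : S !=set0 by exists c1.
have S1 c : S c -> 1 <= c by move=> [_]; exact: rademacher_bound_ge1 r0 y0.
have I1 : 1 <= inf S by apply: lb_le_inf.
have hI : has_inf S by split=> //; exists 1.
have [c Sc cI] := inf_adherent (lt_le_trans ltr01 I1) hI.
exists c; split; [exact: S1|by case: Sc|].
by rewrite mulr_natl mulr2n; exact: ltW.
Qed.

End RademacherConstant.

Section ConvexHull.
Context {R : realType} {disp : measure_display} {X : measurableType disp}.
Variable mu : {measure set X -> \bar R}.
Context {s : scalar_kind} {Y : lmodType (scalars R s)}.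
Variables (T : Y -> X -> scalars R s) (N : Y -> R) (p : R).
Hypothesis T_lin : linear_operator mu T.

(** For homogeneous [N] and up to null sets, the convex hull of zero and of the
    functions [modulus (T y) `^ p] with [N y <= 1]; weights replace the normalisation
    of the vectors. It is to these sets that [multilinear_duality] is applied. *)
Definition power_hull : set (X -> R) := [set g | exists u : seq (R * Y),
  [/\ forall a, a \in u -> 0 <= a.1, \sum_(a <- u) a.1 * N a.2 `^ p <= 1 &
      g = fun x => \sum_(a <- u) a.1 * modulus (T a.2 x) `^ p]].

Lemma power_hull_measurable g : power_hull g -> measurable_fun setT g.
Proof.
move=> [u [_ _ ->]]; apply: measurable_sum => a; apply: measurable_funM => //.
apply: (@measurableT_comp _ _ _ _ _ _ (@powR R ^~ p)) => //.
exact: (measurable_modulus T_lin).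
Qed.

Lemma power_hull_ge0 g x : power_hull g -> 0 <= g x.
Proof.
move=> [u [u0 _ ->]]; rewrite big_seq; apply: sumr_ge0 => a /u0 a0.
by rewrite mulr_ge0 ?powR_ge0.
Qed.

Lemma power_hull0 : power_hull (fun=> 0).
Proof.
exists [::]; split=> //; first by rewrite big_nil.
by apply/funext => x; rewrite big_nil.
Qed.

Lemma power_hull_convex g h t : power_hull g -> power_hull h -> 0 <= t <= 1 ->
  power_hull (fun x => (1 - t) * g x + t * h x).
Proof.
move=> [u [u0 u1 ->]] [v [v0 v1 ->]] /andP[t0 t1].
have t1' : 0 <= 1 - t by rewrite subr_ge0.
exists ([seq ((1 - t) * a.1, a.2) | a <- u] ++ [seq (t * a.1, a.2) | a <- v]).
have scale (c : R) (l : seq (R * Y)) (F : Y -> R) :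
    \sum_(a <- [seq (c * a.1, a.2) | a <- l]) a.1 * F a.2 =
    c * \sum_(a <- l) a.1 * F a.2.
  by rewrite big_map mulr_sumr; apply: eq_bigr => a _; rewrite mulrA.
split.
- move=> a; rewrite mem_cat => /orP[] /mapP[b bl ->] /=.
    by rewrite mulr_ge0// u0.
  by rewrite mulr_ge0// v0.
- rewrite big_cat/= (scale _ _ (fun y => N y `^ p)) (scale _ _ (fun y => N y `^ p)).
  have := ler_wpM2l t1' u1; have := ler_wpM2l t0 v1; lra.
- apply/funext => x; rewrite big_cat/=.
  by rewrite (scale _ _ (fun y => modulus (T y x) `^ p)) (scale _ _ (fun y => modulus (T y x) `^ p)).
Qed.

Lemma power_hull1 (w : R) y : 0 <= w -> w * N y `^ p <= 1 ->
  power_hull (fun x => w * modulus (T y x) `^ p).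
Proof.
move=> w0 w1; exists [:: (w, y)]; split.
- by move=> a; rewrite inE => /eqP ->.
- by rewrite big_seq1.
- by apply/funext => x; rewrite big_seq1.
Qed.

Lemma power_hull_saturates : saturates mu T ->
  forall E, measurable E -> (0 < mu E)%E ->
  exists E', [/\ measurable E', E' `<=` E, (0 < mu E')%E &
    exists2 g, power_hull g & forall x, E' x -> 0 < g x].
Proof.
move=> sT E mE E0; have [E' [mE' E'E E'0 [h hh]]] := sT E mE E0.
have mh : measurable_fun setT (fun x => modulus (T h x)) by exact: (measurable_modulus T_lin).
pose D := [set x | 0 < modulus (T h x)].
have mD : measurable D.
  have := measurable_fun_ltr (@measurable_cst _ _ _ _ setT (0 : R)) mh.
  by move=> /(_ measurableT [set true]); rewrite setTI; apply.
exists (E' `&` D); split.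
- exact: measurableI.
- by apply: subset_trans E'E => x [].
- rewrite lt0e measure_ge0 andbT; apply: contraTneq E'0 => E'D0.
  rewrite -leNgt measure_le0; apply/eqP.
  have h0 : mu (E' `\` D) = 0%E.
    apply: (measure_negligible (measurableD mE' mD)).
    apply: negligibleS hh => x [E'x nDx] /= hx; exact: nDx (hx E'x).
  have : mu (E' `&` D `|` E' `\` D) = 0%E.
    by rewrite measureU0//; [exact: measurableI|exact: measurableD].
  by rewrite setUIDK.
- pose w := (1 + N h `^ p)^-1.
  have w0 : 0 < w by rewrite invr_gt0 ltr_pwDl ?powR_ge0.
  exists (fun x => w * modulus (T h x) `^ p); last first.
    by move=> x [_ Dx]; rewrite mulr_gt0// powR_gt0.
  apply: power_hull1; first exact: ltW.
  by rewrite /w mulrC ler_pdivrMr ?mul1r ?lerDr// ltr_pwDl// powR_ge0.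
Qed.

End ConvexHull.

Theorem theorem4p3 (R : realType) (d : nat) (theta p r : 'I_d -> R)
  (hp : forall j, 0 < p j <= 2)
  (htheta : forall j, 0 < theta j)
  (hsum : \sum_(j < d) theta j = 1)
  (hr : forall j, 0 < r j <= 2)
  (hr2 : forall j, p j = 2 -> r j = 2)
  (hrp : forall j, p j < 2 -> p j < r j) :
  exists2 C : R, 0 < C &
  forall (s : scalar_kind) (disp : measure_display) (X : measurableType disp)
    (mu : {sigma_finite_measure set X -> \bar R})
    (Y : 'I_d -> lmodType (scalars R s)) (nrm : forall j, Y j -> R)
    (T : forall j, Y j -> X -> scalars R s) (B : R),
    (forall j, quasi_norm (nrm j)) ->
    (forall j, linear_operator mu (T j)) ->
    (forall j, saturates mu (T j)) ->
    0 <= B ->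
    (forall f : (forall j, Y j),
      (\int[mu]_x (\prod_(j < d) modulus (T j (f j) x) `^ (p j * theta j))%:E
       <= (B * \prod_(j < d) nrm j (f j) `^ (p j * theta j))%:E)%E) ->
    (forall j, has_rademacher_type (nrm j) (r j)) ->
    exists phi : 'I_d -> X -> R,
      [/\ forall j, measurable_fun setT (phi j),
          forall j x, 0 <= phi j x,
          {ae mu, forall x, 1 <= \prod_(j < d) phi j x `^ theta j} &
          forall j (f : Y j),
            ((\int[mu]_x (modulus (T j f x) `^ p j * phi j x)%:E) `^ (p j)^-1
             <= (C * B `^ (p j)^-1 * rademacher_const (nrm j) (r j)
                 * nrm j f)%:E)%E].
Proof.
have theta_le1 j : theta j <= 1.
  by rewrite -hsum (bigD1 j)//= lerDl sumr_ge0// => i _; exact: ltW.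
have p0 j : 0 < p j by case/andP: (hp j).
have r0 j : 0 < r j by case/andP: (hr j).
have /choice[K HK] : forall j, exists K, 0 < K /\ randomizes (theta j) (p j) (r j) K.
  move=> j; have th01 : 0 < theta j <= 1 by rewrite htheta theta_le1.
  by have [K K0 HK] := randomization th01 (hp j) (hr2 j) (hrp j); exists K.
have K0 j : 0 < K j by case: (HK j).
pose Q : R := (\prod_j K j) * (\prod_j K j).
have Q0 : 0 < Q by rewrite mulr_gt0// prodr_gt0.
(* The factor 2 pays for [c j <= 2 * rademacher_const]. *)
pose c0 j : R := 2 * (8 / theta j * Q) `^ (p j)^-1.
have c00 j : 0 <= c0 j by rewrite mulr_ge0 ?powR_ge0.
exists (1 + \sum_j c0 j); first by rewrite ltr_pwDl// sumr_ge0.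
move=> s disp X mu Y nrm T B qn lT sT B0 hB rt.
have C_ge j : c0 j <= 1 + \sum_j c0 j.
  by rewrite (bigD1 j)//= addrCA lerDl addr_ge0// sumr_ge0.
have n0 j f : 0 <= nrm j f by case: (qn j).
(* On a null space the Rademacher constant may vanish; any weights do. *)
have [muT|muT] := eqVneq (mu setT) 0%E.
  exists (fun _ _ => 1); split=> //.
    by apply: measure0_ae.
  move=> j f; have -> : (\int[mu]_x (modulus (T j f x) `^ p j * 1)%:E = 0)%E.
    have mg : measurable_fun setT (fun x => modulus (T j f x) `^ p j * 1).
      apply: measurable_funM => //.
      apply: (@measurableT_comp _ _ _ _ _ _ (@powR R ^~ (p j))) => //.
      exact: (measurable_modulus (lT j)).
    rewrite (@ge0_ae_eq_integral _ _ _ mu setT _ (cst 0%E))//.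
    - by rewrite integral0.
    - exact/measurable_EFinP.
    - by move=> x _; rewrite lee_fin mulr1 powR_ge0.
    - exact: ae_eq0.
  rewrite poweR0r ?invr_eq0 ?gt_eqF// lee_fin !mulr_ge0 ?powR_ge0 ?n0//.
    by rewrite addr_ge0// sumr_ge0.
  exact: rademacher_const_ge0.
have muT0 : (0 < mu setT)%E by rewrite lt0e muT measure_ge0.
have nondeg j : exists y : Y j, 0 < nrm j y.
  have [E [mE _ E0 [h hh]]] := sT j _ measurableT muT0.
  exists h; rewrite lt0r n0 andbT; apply/negP => /eqP nh0.
  have hz : h = 0 by case: (qn j) => _ + _ _; apply.
  have : mu.-negligible E.
    have h0 := linear_operator0 (lT j).
    have h1 : {ae mu, forall x, ~ E x}.
      apply: filterS2 hh h0 => x; rewrite hz => h1 h2 /h1.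
      by rewrite h2 modulus0 ltxx.
    by apply: negligibleS h1 => x Ex /=; apply.
  by move/(measure_negligible mE) => h0; rewrite h0 ltxx in E0.
have /choice[c Hc] j : exists c, [/\ 1 <= c, rademacher_bound (nrm j) (r j) c &
    c <= 2 * rademacher_const (nrm j) (r j)].
  have [y y0] := nondeg j.
  exact: (rademacher_const_approx (qn j) (r0 j) y0 (rt j)).
have c_ge0 j : 0 <= c j by case: (Hc j) => /(le_trans ler01).
(* Scaling the norm by the Rademacher constant of [Y j] alone makes the final bound
   for [T j] depend on no other space. *)
pose G j := power_hull (T j) (fun y => c j * nrm j y) (p j).
have [] := @multilinear_duality R disp X mu (sigma_finiteT mu) 'I_d theta G (B * Q)
  htheta hsum.
- by move=> j g Gg; exact: (power_hull_measurable (lT j) Gg).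
- by move=> j g x Gg; exact: (power_hull_ge0 x Gg).
- by move=> j; exact: power_hull0.
- by move=> j g h t; exact: power_hull_convex.
- by move=> j E mE E0; exact: (power_hull_saturates _ _ (lT j) (sT j) mE E0).
- move=> g Gg.
  have Hex j : exists z : seq (R * Y j),
    [/\ forall i, 0 <= (nth (0, 0) z i).1,
      {ae mu, forall x, g j x `^ theta j
        <= K j * \sum_(a <- z) a.1 * modulus (T j a.2 x) `^ (p j * theta j)} &
      \sum_(a <- z) a.1 * nrm j a.2 `^ (p j * theta j) <= K j].
    have [u [u0 u1 ->]] := Gg j.
    have [_ HKj] := HK j.
    have [_ rb _] := Hc j.
    exact: HKj (qn j) (lT j) (c_ge0 j) rb u u0 u1.
  pose z j := sval (cid (Hex j)).
  have Hz j := svalP (cid (Hex j)); rewrite -/(z _) in Hz.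
  have z0 j i : 0 <= (nth (0, 0) (z j) i).1 by case: (Hz j).
  have wz0 j (F : Y j -> R) : (forall y, 0 <= F y) -> 0 <= \sum_(a <- z j) a.1 * F a.2.
    move=> F0; rewrite (big_nth (0, 0)); apply: sumr_ge0 => i _.
    by apply: mulr_ge0; [exact: z0|exact: F0].
  pose S j x := \sum_(a <- z j) a.1 * modulus (T j a.2 x) `^ (p j * theta j).
  have S0 j x : 0 <= S j x.
    apply: (wz0 j (fun y => modulus (T j y x) `^ (p j * theta j))) => y.
    exact: powR_ge0.
  have mS j : measurable_fun setT (S j).
    apply: measurable_sum => a; apply: measurable_funM => //.
    apply: (@measurableT_comp _ _ _ _ _ _ (@powR R ^~ (p j * theta j))) => //.
    exact: (measurable_modulus (lT j)).
  have mpS : measurable_fun setT (fun x => \prod_j S j x).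
    by apply: measurable_prod => j _; exact: mS.
  have PK0 : 0 <= \prod_j K j by apply: prodr_ge0 => j _; exact: ltW.
  apply: (@le_trans _ _ (\int[mu]_x ((\prod_j K j)%:E * (\prod_j S j x)%:E))%E).
    apply: ae_ge0_le_integral => //.
    - by move=> x _; rewrite lee_fin; exact: gmean_ge0.
    - apply/measurable_EFinP; apply: measurable_gmean => j.
      exact: (power_hull_measurable (lT j) (Gg j)).
    - by move=> x _; rewrite -EFinM lee_fin mulr_ge0// prodr_ge0.
    - by apply: measurable_funeM; exact/measurable_EFinP.
    - have H : {ae mu, forall x j, g j x `^ theta j <= K j * S j x}.
        by apply: ae_forall_finType => j; case: (Hz j).
      apply: filterS H => x H _; rewrite -EFinM lee_fin -big_split/=.
      by apply: ler_prod => j _; rewrite powR_ge0 H.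
  have pS0 x : [set: X] x -> (0 <= (\prod_j S j x)%:E)%E.
    by rewrite lee_fin prodr_ge0.
  rewrite (@ge0_integralZl_EFin _ _ _ mu setT measurableT _ pS0)//; last first.
    exact/measurable_EFinP.
  apply: (@le_trans _ _ ((\prod_j K j)%:E * (B * \prod_j K j)%:E)%E); last first.
    by rewrite -EFinM lee_fin /Q mulrCA mulrA.
  apply: lee_wpmul2l; first by rewrite lee_fin.
  apply: le_trans (averaged_inequality lT hB z0) _.
  rewrite lee_fin ler_wpM2l//; apply: ler_prod => j _.
  rewrite (wz0 j (fun y => nrm j y `^ (p j * theta j)))/=; last first.
    by move=> y; exact: powR_ge0.
  by case: (Hz j).
move=> phi [mphi phi0 phi1 phiG]; exists phi; split=> // j f.
have pn0 : p j != 0 by rewrite gt_eqF.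
have mf : measurable_fun setT (fun x => modulus (T j f x) `^ p j).
  apply: (@measurableT_comp _ _ _ _ _ _ (@powR R ^~ (p j))) => //.
  exact: (measurable_modulus (lT j)).
have mfp : measurable_fun setT (fun x => (modulus (T j f x) `^ p j * phi j x)%:E).
  by apply/measurable_EFinP; apply: measurable_funM.
have fp0 x : (0 <= (modulus (T j f x) `^ p j * phi j x)%:E)%E.
  by rewrite lee_fin mulr_ge0 ?powR_ge0.
have rc0 := rademacher_const_ge0 (nrm j) (r j).
have RHS0 : 0 <= (1 + \sum_j c0 j) * B `^ (p j)^-1 * rademacher_const (nrm j) (r j) * nrm j f.
  by rewrite !mulr_ge0 ?powR_ge0 ?n0// addr_ge0// sumr_ge0.
have [f0|f_neq0] := eqVneq (nrm j f) 0.
  have fz : f = 0 by case: (qn j) => _ + _ _; apply.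
  have -> : (\int[mu]_x (modulus (T j f x) `^ p j * phi j x)%:E = 0)%E.
    rewrite (@ge0_ae_eq_integral _ _ _ mu setT _ (cst 0%E))//.
      by rewrite integral0.
    apply: filterS (linear_operator0 (lT j)) => x h _.
    by rewrite fz h modulus0 powR0// mul0r.
  by rewrite poweR0r ?invr_eq0// lee_fin.
have f_gt0 : 0 < nrm j f by rewrite lt0r f_neq0 n0.
have [c1 _ c2] := Hc j.
have cf0 : 0 < c j * nrm j f by rewrite mulr_gt0// (lt_le_trans ltr01).
pose V := (c j * nrm j f) `^ p j.
have V0 : 0 < V by rewrite powR_gt0.
have Gf : G j (fun x => V^-1 * modulus (T j f x) `^ p j).
  by apply: power_hull1; rewrite ?invr_ge0 ?(ltW V0)// mulVf// gt_eqF.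
have bound : (\int[mu]_x (modulus (T j f x) `^ p j * phi j x)%:E
    <= (V * (8 / theta j * (B * Q)))%:E)%E.
  have h := phiG j _ Gf.
  have E : (\int[mu]_x (V^-1 * modulus (T j f x) `^ p j * phi j x)%:E =
      (V^-1)%:E * \int[mu]_x (modulus (T j f x) `^ p j * phi j x)%:E)%E.
    rewrite -ge0_integralZl_EFin//; last by rewrite invr_ge0 ltW.
    by apply: eq_integral => x _; rewrite -EFinM mulrA.
  by move: h; rewrite E lee_pdivrMl// -EFinM.
have pinv0 : 0 <= (p j)^-1 by rewrite invr_ge0 ltW.
have b0 : 0 <= V * (8 / theta j * (B * Q)).
  apply: mulr_ge0; first exact: ltW.
  apply: mulr_ge0; first by rewrite divr_ge0// ltW.
  by apply: mulr_ge0 => //; exact: ltW.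
apply: (@le_trans _ _ ((V * (8 / theta j * (B * Q)))%:E `^ (p j)^-1)%E).
  apply: gt0_ler_poweR => //; rewrite in_itv/= ?leey ?andbT//.
  exact: integral_ge0.
rewrite poweR_EFin lee_fin.
have -> : V * (8 / theta j * (B * Q)) = V * (8 / theta j * Q * B) by ring.
have q0 : 0 <= 8 / theta j * Q by rewrite mulr_ge0 ?(ltW Q0)// divr_ge0// ltW.
rewrite (powRM _ (ltW V0) (mulr_ge0 q0 B0)) (powRM _ q0 B0).
rewrite -powRrM divff// (powRr1 (ltW cf0)).
set b := B `^ _; set q := (_ * Q) `^ _.
have b0' : 0 <= b by exact: powR_ge0.
have q0' : 0 <= q by exact: powR_ge0.
have -> : c j * nrm j f * (q * b) = q * c j * b * nrm j f by ring.
rewrite ler_wpM2r// [leRHS]mulrAC; apply: ler_wpM2r => //.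
apply: (@le_trans _ _ (c0 j * rademacher_const (nrm j) (r j))).
  by rewrite /c0 -/q -mulrA mulrCA ler_wpM2l.
by rewrite ler_wpM2r.
Qed.
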